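(* Let $k>0$. Consider the one-dimensional Euler-Poisson system on $(x,t)\in\mathbb{R}\times\mathbb{R}^+$ $$\rho_t+(\rho u)_x=0,\qquad u_t+uu_x=kE,\qquad E_x=\rho,$$ with initial data $\rho(x,0)=\rho_0(x)>0$, $\rho_0\in C^1(\mathbb{R})$, and $u(x,0)=u_0(x)$, $u_0\in C^1(\mathbb{R})$. The system admits a global smooth solution if and only if $$u_0'(\alpha)>-\sqrt{2k\rho_0(\alpha)}\qquad\forall\,\alpha\in\mathbb{R}.$$ In this case the solution is given, along the characteristics $x(\alpha,t)$, by $$\rho(x(\alpha,t),t)=\frac{\rho_0(\alpha)}{\Gamma(\alpha,t)},\qquad u_x(x(\alpha,t),t)=\frac{u_0'(\alpha)+k\rho_0(\alpha)t}{\Gamma(\alpha,t)},\qquad \Gamma(\alpha,t):=1+u_0'(\alpha)t+\tfrac{k}{2}\rho_0(\alpha)t^2,$$ so that $\rho\sim t^{-2}$ and $u_x\sim t^{-1}$ as $t\to\infty$ along each characteristic with $\rho_0(\alpha)\neq0$. If the condition fails (at some $\alpha$), then the solution breaks down at the finite time $t_c$ where $\Gamma(\alpha,t_c)=0$.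
   Context: The total charge $\int_{\mathbb{R}}\rho\,dx$ is assumed finite, and the electric field is $E(x,t)=\frac12\left(\int_{-\infty}^x\rho(\xi,t)\,d\xi-\int_x^\infty\rho(\xi,t)\,d\xi\right)$. The characteristic curve $x(\alpha,t)$ is defined by $\frac{d}{dt}x(\alpha,t)=u(x(\alpha,t),t)$, $x(\alpha,0)=\alpha$. A global smooth solution is a classical solution for all $t\ge0$ for which $\rho$ and $u_x$ stay finite along the characteristics; ''breaks down'' means that $\rho$ and $u_x$ become unbounded along a characteristic in finite time.
   Formalization: The mass equation is required in conservation form (integrated over every [a,b]), with density only continuous, since for u_0 merely C^1 the density need not be differentiable; for u_0 in C^2 the pointwise equation with C^1 density is also proved. *)

(* Defs.v *)
From Stdlib Require Export Reals.
From Coquelicot Require Export Coquelicot.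
From Stdlib Require Import Lra.
Open Scope R_scope.

Definition C1 (f : R -> R) : Prop :=
  (forall x, ex_derive f x) /\ (forall x, continuous (Derive f) x).

Definition C2 (f : R -> R) : Prop := C1 f /\ C1 (Derive f).

(* Functions of space and time are written [f x t]; the time interval is
   [0, T), with [T = p_infty] for [0, +oo). *)
Definition in_time (T : Rbar) (t : R) : Prop := 0 <= t /\ Rbar_lt t T.

(* Time derivative on the half-line [0, +oo): two-sided for t > 0, and the
   right derivative at t = 0. *)
Definition is_tderive (f : R -> R) (t l : R) : Prop :=
  filterlim (fun h => (f (t + h) - f t) / h)
            (within (fun h => h <> 0 /\ 0 <= t + h) (locally 0)) (locally l).

(* Joint continuity on R x [0, T), relative to R x [0, +oo). *)
Definition continuous_on_strip (T : Rbar) (f : R -> R -> R) : Prop :=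
  forall x t, in_time T t ->
    filterlim (fun p : R * R => f (fst p) (snd p))
              (within (fun p : R * R => 0 <= snd p) (locally (x, t)))
              (locally (f x t)).

Definition C1_on_strip (T : Rbar) (f fx ft : R -> R -> R) : Prop :=
  (forall x t, in_time T t ->
     is_derive (fun y => f y t) x (fx x t) /\ is_tderive (f x) t (ft x t)) /\
  continuous_on_strip T f /\ continuous_on_strip T fx /\ continuous_on_strip T ft.

Definition finite_charge (r : R -> R) : Prop :=
  ex_RInt_gen r (Rbar_locally m_infty) (Rbar_locally p_infty).

Definition electric_field (rho : R -> R -> R) (x t : R) : R :=
  / 2 * (RInt_gen (fun xi => rho xi t) (Rbar_locally m_infty) (at_point x)
         - RInt_gen (fun xi => rho xi t) (at_point x) (Rbar_locally p_infty)).

(* rho_t + (rho u)_x = 0 with rho of class C^1. *)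
Definition mass_pointwise (T : Rbar) (rho u : R -> R -> R) : Prop :=
  exists rhox rhot : R -> R -> R,
    C1_on_strip T rho rhox rhot /\
    forall x t, in_time T t ->
      ex_derive (fun y => rho y t * u y t) x /\
      rhot x t + Derive (fun y => rho y t * u y t) x = 0.

(* rho_t + (rho u)_x = 0 in conservation form, integrated over [a, b]; it
   makes sense for rho merely continuous. When u_0 is only C^1 the density
   rho_0 / Gamma transported by the flow is in general not differentiable in x
   or t separately, since Gamma involves u_0'. It is implied by
   [mass_pointwise], see [mass_pointwise_conservation]. *)
Definition mass_conservation (T : Rbar) (rho u : R -> R -> R) : Prop :=
  forall a b t, in_time T t ->
    is_tderive (fun s => RInt (fun x => rho x s) a b) t
               (rho a t * u a t - rho b t * u b t).

(* [ux] and [ut] are the partial derivatives of u, so u is of class C^1 on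
   R x [0, T). *)
Record classical_solution (k : R) (rho0 u0 : R -> R) (T : Rbar)
    (rho u : R -> R -> R) : Prop := {
  sol_rho_continuous : continuous_on_strip T rho;
  sol_charge : forall t, in_time T t -> finite_charge (fun x => rho x t);
  sol_mass : mass_conservation T rho u;
  sol_momentum : exists ux ut : R -> R -> R,
    C1_on_strip T u ux ut /\
    forall x t, in_time T t ->
      ut x t + u x t * ux x t = k * electric_field rho x t;
  sol_poisson : forall x t, in_time T t ->
    is_derive (fun y => electric_field rho y t) x (rho x t);
  sol_rho_init : forall x, rho x 0 = rho0 x;
  sol_u_init : forall x, u x 0 = u0 x
}.

Definition characteristic (u : R -> R -> R) (T : Rbar) (alpha : R)
    (X : R -> R) : Prop :=
  X 0 = alpha /\ forall t, in_time T t -> is_tderive X t (u (X t) t).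

Definition u_x (u : R -> R -> R) (x t : R) : R := Derive (fun y => u y t) x.

(* For f continuous on [0, tc), this is unboundedness as t -> tc. *)
Definition unbounded_before (tc : R) (f : R -> R) : Prop :=
  forall M, exists t, 0 <= t < tc /\ M < Rabs (f t).

Definition bounded_on (t1 : R) (f : R -> R) : Prop :=
  exists M, forall t, 0 <= t <= t1 -> Rabs (f t) <= M.

Definition global_smooth_solution (k : R) (rho0 u0 : R -> R)
    (rho u : R -> R -> R) : Prop :=
  classical_solution k rho0 u0 p_infty rho u /\
  forall alpha X, characteristic u p_infty alpha X ->
    forall t1, bounded_on t1 (fun t => rho (X t) t) /\
               bounded_on t1 (fun t => u_x u (X t) t).

Definition Gamma (k : R) (rho0 u0 : R -> R) (alpha t : R) : R :=
  1 + Derive u0 alpha * t + k / 2 * rho0 alpha * t ^ 2.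

(* f ~ t^(-n) as t -> +oo, up to a positive constant factor. *)
Definition decays_like (n : nat) (f : R -> R) : Prop :=
  exists c : R, 0 < c /\ is_lim (fun t => t ^ n * f t) p_infty c.

Lemma is_derive_is_tderive (f : R -> R) (t l : R) :
  is_derive f t l -> is_tderive f t l.
Proof.
  intros H. apply is_derive_Reals in H.
  apply filterlim_locally. intros eps.
  destruct (H eps (cond_pos eps)) as [d Hd].
  exists d. intros h Hh [Hh0 _].
  apply Hd; [exact Hh0|].
  replace h with (h - 0) by ring. exact Hh.
Qed.

Lemma is_tderive_is_derive (f : R -> R) (t l : R) :
  0 < t -> is_tderive f t l -> is_derive f t l.
Proof.
  intros Ht H. apply is_derive_Reals. intros eps Heps.
  destruct (proj1 (filterlim_locally _ _) H (mkposreal eps Heps)) as [d Hd].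
  assert (Hm : 0 < Rmin d t) by (apply Rmin_pos; [apply cond_pos | exact Ht]).
  exists (mkposreal _ Hm). simpl. intros h Hh0 Hh.
  apply Hd.
  - change (Rabs (h - 0) < d). rewrite Rminus_0_r.
    apply Rlt_le_trans with (1 := Hh), Rmin_l.
  - split; [exact Hh0|].
    assert (Rabs h < t) by (apply Rlt_le_trans with (1 := Hh), Rmin_r).
    apply Rabs_def2 in H0. lra.
Qed.

Lemma is_tderive_ext (f g : R -> R) (t l : R) :
  0 <= t -> (forall s, 0 <= s -> f s = g s) -> is_tderive f t l -> is_tderive g t l.
Proof.
  intros Ht Hfg H. apply filterlim_locally. intros eps.
  destruct (proj1 (filterlim_locally _ _) H eps) as [d Hd].
  exists d. intros h Hh Hp. rewrite <- !Hfg by (try lra; apply Hp).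
  apply Hd; assumption.
Qed.

Lemma continuous_on_strip_x T f x t :
  continuous_on_strip T f -> in_time T t -> continuous (fun y => f y t) x.
Proof.
  intros Hf Ht. apply filterlim_locally. intros eps.
  destruct (proj1 (filterlim_locally _ _) (Hf x t Ht) eps) as [d Hd].
  exists d. intros y Hy. apply (Hd (y, t)); [|apply Ht].
  split; [exact Hy | apply ball_center].
Qed.

Lemma Rmax0_contract s t : Rabs (Rmax 0 s - Rmax 0 t) <= Rabs (s - t).
Proof.
  unfold Rmax. destruct (Rle_dec 0 s), (Rle_dec 0 t); unfold Rabs;
  repeat destruct Rcase_abs; lra.
Qed.

Lemma continuous_on_strip_ext T f x t :
  continuous_on_strip T f -> in_time T t ->
  continuity_2d_pt (fun s y => f y (Rmax 0 s)) t x.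
Proof.
  intros Hf Ht. apply continuity_2d_pt_filterlim, filterlim_locally. intros eps.
  rewrite (Rmax_right 0 t) by apply Ht.
  destruct (proj1 (filterlim_locally _ _) (Hf x t Ht) eps) as [d Hd].
  exists d. intros [s y] [Hs Hy]. simpl in *.
  apply (Hd (y, Rmax 0 s)); [|apply Rmax_l].
  split; [exact Hy|].
  change (Rabs (Rmax 0 s - t) < d). rewrite <- (Rmax_right 0 t) by apply Ht.
  apply Rle_lt_trans with (1 := Rmax0_contract _ _). exact Hs.
Qed.

Lemma mass_pointwise_conservation (T : Rbar) (rho u : R -> R -> R) :
  mass_pointwise T rho u -> mass_conservation T rho u.
Proof.
  intros [rx [rt [[Hd [Hc [_ Hct]]] Hm]]] a b t Ht.
  assert (H0 : in_time T 0).
  { split; [lra|]. apply Rbar_le_lt_trans with t; [apply Ht|apply Ht]. }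
  set (re := fun s x => rho x (Rmax 0 s) + Rmin 0 s * rt x 0).
  assert (Hre : forall s, 0 <= s -> forall x, re s x = rho x s).
  { intros s Hs x. unfold re. rewrite Rmax_right, Rmin_left by lra. ring. }
  assert (Hder : forall s : R, Rbar_lt s T -> forall x,
            is_derive (fun z => re z x) s (rt x (Rmax 0 s))).
  { intros s Hs x. destruct (Rtotal_order s 0) as [Hneg | [Hz | Hpos]].
    - rewrite Rmax_left by lra.
      apply is_derive_ext_loc with (fun z => rho x 0 + z * rt x 0).
      + assert (Hp : 0 < - s) by lra. exists (mkposreal _ Hp). intros z Hz.
        apply Rabs_def2 in Hz. simpl in Hz. unfold minus, plus, opp in Hz. simpl in Hz.
        unfold re. rewrite Rmax_left, Rmin_right by lra. reflexivity.
      + auto_derive; [trivial|ring].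
    - subst s. rewrite Rmax_left by lra. apply is_derive_Reals. intros eps Heps.
      destruct (proj1 (filterlim_locally _ _) (proj2 (Hd x 0 H0))
                  (mkposreal eps Heps)) as [d Hdd].
      exists d. intros h Hh0 Hh. rewrite (Hre 0) by lra.
      destruct (Rle_lt_dec 0 h) as [Hle | Hlt].
      + rewrite Hre by lra. apply Hdd; [|lra].
        change (Rabs (h - 0) < d). rewrite Rminus_0_r. exact Hh.
      + unfold re. rewrite Rmax_left, Rmin_right by lra.
        replace ((rho x 0 + (0 + h) * rt x 0 - rho x 0) / h - rt x 0)
          with 0 by (field; lra).
        rewrite Rabs_R0. exact Heps.
    - rewrite Rmax_right by lra.
      apply is_derive_ext_loc with (rho x).
      + exists (mkposreal _ Hpos). intros z Hz.
        apply Rabs_def2 in Hz. simpl in Hz. unfold minus, plus, opp in Hz. simpl in Hz.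
        symmetry. apply Hre. lra.
      + apply is_tderive_is_derive; [exact Hpos|]. apply Hd. split; [lra|exact Hs]. }
  assert (Hloc : locally t (fun s : R => Rbar_lt s T)).
  { apply open_Rbar_lt. apply Ht. }
  assert (Hcontre : forall s : R, Rbar_lt s T -> forall x, continuous (re s) x).
  { intros s Hs x.
    assert (Hs' : in_time T (Rmax 0 s)).
    { split; [apply Rmax_l|]. unfold Rmax. destruct Rle_dec; [exact Hs|apply H0]. }
    apply (continuous_plus (fun x => rho x (Rmax 0 s))
                           (fun x => Rmin 0 s * rt x 0)).
    - apply (continuous_on_strip_x T); assumption.
    - apply (continuous_mult (fun _ => Rmin 0 s) (fun x => rt x 0)).
      + apply continuous_const.
      + apply (continuous_on_strip_x T); assumption. }
  assert (HI : is_derive (fun s => RInt (re s) a b) t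
                 (RInt (fun x => Derive (fun z => re z x) t) a b)).
  { apply (is_derive_RInt_param re a b t).
    - apply filter_imp with (2 := Hloc). intros s Hs x _. eexists. now apply Hder.
    - intros x _. apply continuity_2d_pt_ext_loc with (fun s y => rt y (Rmax 0 s)).
      + destruct Hloc as [d Hdl]. exists d. intros s y Hs _. symmetry.
        apply is_derive_unique, Hder, Hdl. exact Hs.
      + apply (continuous_on_strip_ext T); assumption.
    - apply filter_imp with (2 := Hloc). intros s Hs.
      apply (ex_RInt_continuous (re s)). intros x _. now apply Hcontre. }
  assert (Hv : RInt (fun x => Derive (fun z => re z x) t) a b
               = rho a t * u a t - rho b t * u b t).
  { apply is_RInt_unique.
    set (g := fun x => rho x t * u x t).
    replace (rho a t * u a t - rho b t * u b t) with (opp (minus (g b) (g a)))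
      by (unfold g, opp, minus, plus; simpl; unfold opp; simpl; ring).
    apply is_RInt_ext with (fun x => opp (Derive g x)).
    - intros x _. destruct (Hm x t Ht) as [_ E].
      replace (Derive (fun z => re z x) t) with (rt x t).
      + unfold opp, g; simpl. lra.
      + symmetry. apply is_derive_unique.
        assert (Q := Hder t (proj2 Ht) x).
        rewrite Rmax_right in Q by apply Ht. exact Q.
    - apply (is_RInt_opp (Derive g)), (is_RInt_derive g (Derive g)).
      + intros x _. apply Derive_correct, Hm, Ht.
      + intros x _. apply continuous_ext with (fun x => - rt x t).
        * intros y. destruct (Hm y t Ht) as [_ E]. unfold g. lra.
        * apply (continuous_opp (fun x => rt x t)).
          apply (continuous_on_strip_x T); assumption. }
  apply is_tderive_ext with (fun s => RInt (re s) a b).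
  - apply Ht.
  - intros s Hs. apply RInt_ext. intros x _. now apply Hre.
  - rewrite <- Hv. now apply is_derive_is_tderive.
Qed.

(* Main.v *)
(* Mass conservation gives a stream function of the mass which, up to an unknown
   function g of time alone, is the electric field. Let Y(a, t) be the parabola
   a + u0(a) t + k E0(a) t^2 / 2, shifted by the drift F with F'' = k g. The
   errors u(Y, t) - Y' and E(Y, t) - E0(a) - g solve a homogeneous linear system
   of ordinary differential equations, so they vanish: the parabolas are the
   characteristics, and no existence theorem for the flow of u is needed.
   Differentiating in a yields rho(Y, t) Gamma = rho0 and u_x(Y, t) Gamma = Gamma',
   hence Gamma > 0. Then Y(., t) maps R onto R, and as the field takes opposite
   limits at both ends, g = 0. Conversely, if Gamma > 0, inverting the flow gives
   the solution, so the problem reduces to the sign of the quadratic Gamma. *)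

Require Import Defs.
From Stdlib Require Import Lra ClassicalEpsilon.

(** * Calculus on the half-line and on strips *)

(** The field integrates [rho] over half-lines, and nothing is known about [rho u] at infinity, so
    its time derivative cannot be found by differentiating under the integral. This is the origin of
    [g]. Since [rho] is only continuous, its equation cannot be integrated along curves either: what
    is known of [rho] and [u_x] comes from differentiating in the label [a] the identities for the
    field and the velocity. The parabolas solve [x'' = k E0(a)]: trajectories do not cross, so the
    charge on either side of each one, and with it the force, stays constant. The order of the
    argument is forced. Proving [g = 0] requires the parabolas to reach both ends of the line, which
    rests on [Gamma > 0], so positivity has to be obtained while the drift is still present. The
    threshold says that [Gamma], as a quadratic in [t], has no positive zero: either [u0' >= 0], or
    the discriminant [u0'^2 - 2 k rho0] is negative. *)

Lemma filterlim_div_R {I : Type} (F : (I -> Prop) -> Prop) {FF : Filter F}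
    (f g : I -> R) (a b : R) :
  b <> 0 -> filterlim f F (locally a) -> filterlim g F (locally b) ->
  filterlim (fun i => f i / g i) F (locally (a / b)).
Proof.
  intros Hb Hf Hg. unfold Rdiv.
  apply (filterlim_comp_2 f (fun i => / g i) Rmult Hf (H := locally (/ b))).
  - apply filterlim_comp with (1 := Hg).
    apply (filterlim_Rbar_inv b). now intros E; injection E.
  - apply (filterlim_mult a (/ b)).
Qed.

Lemma filterlim_mult_R {I : Type} (F : (I -> Prop) -> Prop) {FF : Filter F}
    (f g : I -> R) (a b : R) :
  filterlim f F (locally a) -> filterlim g F (locally b) ->
  filterlim (fun i => f i * g i) F (locally (a * b)).
Proof.
  intros Hf Hg. apply (filterlim_comp_2 f g Rmult Hf Hg), (filterlim_mult a b).
Qed.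

Lemma filterlim_plus_R {I : Type} (F : (I -> Prop) -> Prop) {FF : Filter F}
    (f g : I -> R) (a b : R) :
  filterlim f F (locally a) -> filterlim g F (locally b) ->
  filterlim (fun i => f i + g i) F (locally (a + b)).
Proof.
  intros Hf Hg. apply (filterlim_comp_2 f g Rplus Hf Hg), (filterlim_plus a b).
Qed.

(** The filter inside [is_tderive], named so that limit rules treat [t = 0] and [t > 0] alike. *)
Definition increments (t : R) : (R -> Prop) -> Prop :=
  within (fun h => h <> 0 /\ 0 <= t + h) (locally 0).

#[export] Instance increments_filter t : Filter (increments t).
Proof. apply within_filter, locally_filter. Qed.

Lemma increments_ge0 t : increments t (fun h => 0 <= t + h).
Proof. unfold increments, within. apply filter_forall. now intros h [_ H]. Qed.

Lemma increments_neq0 t : increments t (fun h => h <> 0).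
Proof. unfold increments, within. apply filter_forall. now intros h [H _]. Qed.

Lemma filterlim_increments t :
  filterlim (fun h => t + h) (increments t) (locally t).
Proof.
  apply (filterlim_filter_le_1 (F := locally 0)); [apply filter_le_within|].
  replace (locally t) with (locally (t + 0)) by now rewrite Rplus_0_r.
  apply (continuous_plus (fun _ => t) (fun h => h)).
  - apply continuous_const.
  - apply continuous_id.
Qed.

(** Continuing [f] to negative times by the line of slope [l] turns the right derivative at 0 into
    an ordinary one; for [t > 0] the continuation is invisible near [t]. The differentiation rules
    are then inherited from [is_derive]. *)
Lemma is_tderive_extension (f : R -> R) (t l : R) :
  0 <= t -> is_tderive f t l <->
  exists g, (forall s, 0 <= s -> g s = f s) /\ is_derive g t l.
Proof.
  intros Ht. split.
  - intros H. exists (fun s => f (Rmax 0 s) + Rmin 0 s * l).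
    assert (He : forall s, 0 <= s -> f (Rmax 0 s) + Rmin 0 s * l = f s).
    { intros s Hs. rewrite Rmax_right, Rmin_left by lra. ring. }
    split; [exact He|].
    apply is_derive_Reals. intros eps Heps.
    destruct (proj1 (filterlim_locally _ _) H (mkposreal eps Heps)) as [d Hd].
    destruct (Req_dec t 0) as [-> | Hn].
    + exists d. intros h Hh0 Hh. rewrite (He 0) by lra.
      destruct (Rle_lt_dec 0 (0 + h)) as [Hle | Hlt].
      * rewrite He by lra. apply Hd; [|lra].
        change (Rabs (h - 0) < d). rewrite Rminus_0_r. exact Hh.
      * rewrite Rmax_left, Rmin_right by lra.
        replace ((f 0 + (0 + h) * l - f 0) / h - l) with 0 by (field; lra).
        rewrite Rabs_R0. exact Heps.
    + assert (Hm : 0 < Rmin d t) by (apply Rmin_pos; [apply cond_pos | lra]).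
      exists (mkposreal _ Hm). simpl. intros h Hh0 Hh.
      assert (Rabs h < t) by (apply Rlt_le_trans with (1 := Hh), Rmin_r).
      apply Rabs_def2 in H0. rewrite !He by lra.
      apply Hd; [|lra].
      change (Rabs (h - 0) < d). rewrite Rminus_0_r.
      apply Rlt_le_trans with (1 := Hh), Rmin_l.
  - intros [g [Hg Hd]]. apply (is_tderive_ext g); [exact Ht|exact Hg|].
    now apply is_derive_is_tderive.
Qed.

Lemma is_tderive_comp (phi f : R -> R) (t l m : R) :
  0 <= t -> is_derive phi (f t) l -> is_tderive f t m ->
  is_tderive (fun s => phi (f s)) t (l * m).
Proof.
  intros Ht Hp Hf. apply is_tderive_extension in Hf; [|exact Ht].
  destruct Hf as [g [Hg Hd]].
  apply is_tderive_extension; [exact Ht|].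
  exists (fun s => phi (g s)). split.
  - intros s Hs. now rewrite Hg.
  - rewrite Rmult_comm. apply (is_derive_comp phi g); [|exact Hd].
    now rewrite Hg.
Qed.

Lemma is_tderive_plus (f g : R -> R) (t l m : R) :
  0 <= t -> is_tderive f t l -> is_tderive g t m ->
  is_tderive (fun s => f s + g s) t (l + m).
Proof.
  intros Ht Hf Hg.
  apply is_tderive_extension in Hf; [|exact Ht]. destruct Hf as [f' [Ef Df]].
  apply is_tderive_extension in Hg; [|exact Ht]. destruct Hg as [g' [Eg Dg]].
  apply is_tderive_extension; [exact Ht|].
  exists (fun s => f' s + g' s). split.
  - intros s Hs. now rewrite Ef, Eg.
  - now apply (is_derive_plus f' g').
Qed.

Lemma is_tderive_mult (f g : R -> R) (t l m : R) :
  0 <= t -> is_tderive f t l -> is_tderive g t m ->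
  is_tderive (fun s => f s * g s) t (l * g t + f t * m).
Proof.
  intros Ht Hf Hg.
  apply is_tderive_extension in Hf; [|exact Ht]. destruct Hf as [f' [Ef Df]].
  apply is_tderive_extension in Hg; [|exact Ht]. destruct Hg as [g' [Eg Dg]].
  apply is_tderive_extension; [exact Ht|].
  exists (fun s => f' s * g' s). split.
  - intros s Hs. now rewrite Ef, Eg.
  - rewrite <- Ef, <- Eg by exact Ht.
    apply (is_derive_mult f' g'); [exact Df|exact Dg|exact Rmult_comm].
Qed.

Lemma is_tderive_minus (f g : R -> R) (t l m : R) :
  0 <= t -> is_tderive f t l -> is_tderive g t m ->
  is_tderive (fun s => f s - g s) t (l - m).
Proof.
  intros Ht Hf Hg. unfold Rminus.
  apply is_tderive_plus; [exact Ht|exact Hf|].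
  replace (- m) with (-1 * m) by ring.
  apply (is_tderive_comp Ropp g); [exact Ht| |exact Hg].
  auto_derive; [trivial|ring].
Qed.

Lemma is_tderive_ext_strip (T : Rbar) (f g : R -> R) (t l : R) :
  in_time T t -> (forall s, in_time T s -> f s = g s) ->
  is_tderive f t l -> is_tderive g t l.
Proof.
  intros Ht Hfg.
  apply filterlim_ext_loc.
  assert (HT : increments t (fun h => Rbar_lt (t + h) T)).
  { exact (filterlim_increments t _ (open_Rbar_lt T t (proj2 Ht))). }
  generalize (filter_and _ _ HT (increments_ge0 t)). apply filter_imp.
  intros h [H1 H2]. rewrite <- !Hfg; [reflexivity|exact Ht|]. split; assumption.
Qed.

(** Composing with [Rmax 0] freezes the function at its initial value for negative times, so that
    continuity from the right at 0 becomes plain [continuous]. This encoding is used throughout. *)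
Lemma is_tderive_continuous (f : R -> R) (t l : R) :
  0 <= t -> is_tderive f t l -> continuous (fun s => f (Rmax 0 s)) t.
Proof.
  intros Ht H. apply is_tderive_extension in H; [|exact Ht].
  destruct H as [g [Hg Hd]].
  apply continuous_ext with (fun s => g (Rmax 0 s)).
  { intros s. apply Hg, Rmax_l. }
  apply (continuous_comp (Rmax 0) g).
  - apply filterlim_locally. intros eps. exists eps. intros s Hs.
    apply Rle_lt_trans with (1 := Rmax0_contract _ _). exact Hs.
  - rewrite Rmax_right by exact Ht.
    exact (ex_derive_continuous g t (ex_intro _ l Hd)).
Qed.

Lemma filterlim_along_increments (f : R -> R) (t : R) :
  0 <= t -> continuous (fun s => f (Rmax 0 s)) t ->
  filterlim (fun h => f (t + h)) (increments t) (locally (f t)).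
Proof.
  intros Ht H.
  rewrite <- (Rmax_right 0 t) at 2 by exact Ht.
  apply filterlim_ext_loc with (fun h => f (Rmax 0 (t + h))).
  - generalize (increments_ge0 t). apply filter_imp. intros h Hh.
    now rewrite Rmax_right.
  - apply (filterlim_comp _ _ _ (fun h => t + h) (fun s => f (Rmax 0 s)) _ (locally t));
      [apply filterlim_increments|exact H].
Qed.

Lemma tderive_mean_value (f df : R -> R) (t1 : R) :
  0 <= t1 -> (forall t, 0 <= t <= t1 -> is_tderive f t (df t)) ->
  exists c, 0 <= c <= t1 /\ f t1 - f 0 = df c * t1.
Proof.
  intros H1 Hd.
  destruct (MVT_gen (fun s => f (Rmax 0 s)) 0 t1 df) as [c [Hc E]].
  - rewrite Rmin_left, Rmax_right by lra. intros x Hx.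
    apply is_derive_ext_loc with f.
    + assert (Hx0 : 0 < x) by lra. exists (mkposreal _ Hx0). intros s Hs.
      apply Rabs_def2 in Hs. unfold minus, plus, opp in Hs. simpl in Hs.
      rewrite Rmax_right by lra. reflexivity.
    + apply is_tderive_is_derive; [lra|]. apply Hd. lra.
  - rewrite Rmin_left, Rmax_right by lra. intros x Hx.
    apply continuity_pt_filterlim, is_tderive_continuous with (df x); [lra|].
    apply Hd, Hx.
  - rewrite Rmin_left, Rmax_right in Hc by lra. exists c. split; [exact Hc|].
    rewrite !Rmax_right in E by lra. lra.
Qed.

Lemma in_time_le (T : Rbar) (s t : R) : in_time T t -> 0 <= s <= t -> in_time T s.
Proof.
  intros Ht Hs. split; [apply Hs|].
  apply Rbar_le_lt_trans with t; [apply Hs|apply Ht].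
Qed.

Lemma tderive_zero_const (T : Rbar) (f : R -> R) :
  (forall t, in_time T t -> is_tderive f t 0) ->
  forall t, in_time T t -> f t = f 0.
Proof.
  intros Hd t Ht. destruct (tderive_mean_value f (fun _ => 0) t) as [c [_ E]].
  - apply Ht.
  - intros s Hs. now apply Hd, in_time_le with t.
  - lra.
Qed.

(** The mean value theorem is applied to [exp (- C * t) * z t], whose derivative
    [exp (- C * t) * (dz t - C * z t)] is nonpositive. *)
Lemma gronwall_zero (z dz : R -> R) (C t1 : R) :
  0 <= t1 -> (forall t, 0 <= t <= t1 -> is_tderive z t (dz t)) ->
  (forall t, 0 <= t <= t1 -> dz t <= C * z t) ->
  z 0 = 0 -> z t1 <= 0.
Proof.
  intros H1 Hd Hle H0.
  destruct (tderive_mean_value (fun t => exp (- C * t) * z t)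
    (fun t => - C * exp (- C * t) * z t + exp (- C * t) * dz t) t1 H1)
    as [c [Hc E]].
  - intros t Ht. apply (is_tderive_mult (fun t => exp (- C * t))); [lra| |now apply Hd].
    apply is_derive_is_tderive. auto_derive; [trivial|ring].
  - rewrite H0, Rmult_0_r, Rminus_0_r in E.
    assert (P1 := exp_pos (- C * t1)). assert (Pc := exp_pos (- C * c)).
    assert (Hcc := Hle c Hc).
    assert (E' : exp (- C * t1) * z t1 <= 0).
    { rewrite E. replace (- C * exp (- C * c) * z c + exp (- C * c) * dz c)
        with (exp (- C * c) * (dz c - C * z c)) by ring.
      assert (exp (- C * c) * (dz c - C * z c) <= 0) by nra. nra. }
    destruct (Rle_lt_dec (z t1) 0) as [|Hz]; [assumption|]. nra.
Qed.

Lemma exists_antiderivative (T : Rbar) (w : R -> R) :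
  (forall t, in_time T t -> continuous (fun s => w (Rmax 0 s)) t) ->
  exists W, W 0 = 0 /\ forall t, in_time T t -> is_tderive W t (w t).
Proof.
  intros Hw. exists (fun t => RInt (fun s => w (Rmax 0 s)) 0 t).
  split; [apply (RInt_point 0 (fun s => w (Rmax 0 s)))|].
  intros t Ht. apply is_derive_is_tderive.
  rewrite <- (Rmax_right 0 t) at 2 by apply Ht.
  assert (H0 : in_time T 0) by (apply in_time_le with t; [exact Ht|split; [lra|apply Ht]]).
  assert (Hc : forall s : R, Rbar_lt s T -> continuous (fun s => w (Rmax 0 s)) s).
  { intros s Hs. destruct (Rle_lt_dec 0 s) as [H|H]; [apply Hw; split; assumption|].
    apply continuous_ext_loc with (fun _ => w 0).
    - assert (Hp : 0 < - s) by lra. exists (mkposreal _ Hp). intros z Hz.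
      apply Rabs_def2 in Hz. simpl in Hz. unfold minus, plus, opp in Hz. simpl in Hz.
      rewrite Rmax_left by lra. reflexivity.
    - apply continuous_const. }
  apply (is_derive_RInt (fun s => w (Rmax 0 s)) _ 0 t); [|apply Hc, Ht].
  apply filter_imp with (2 := open_Rbar_lt T t (proj2 Ht)). intros b Hb.
  apply (RInt_correct (fun s => w (Rmax 0 s))).
  apply (ex_RInt_continuous (fun s => w (Rmax 0 s))). intros z Hz. apply Hc.
  apply Rbar_le_lt_trans with (Rmax 0 b); [apply Hz|].
  unfold Rmax. destruct Rle_dec; [exact Hb|apply H0].
Qed.

(** Point and time may both depend on an index running along any filter, so one statement covers
    increments in time, increments in space and neighbourhoods in the strip. *)
Lemma filterlim_on_strip {I : Type} (F : (I -> Prop) -> Prop) {FF : Filter F}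
    (T : Rbar) (f : R -> R -> R) (a s : I -> R) (x t : R) :
  continuous_on_strip T f -> in_time T t ->
  filterlim a F (locally x) -> filterlim s F (locally t) -> F (fun i => 0 <= s i) ->
  filterlim (fun i => f (a i) (s i)) F (locally (f x t)).
Proof.
  intros Hf Ht Ha Hs H0 P HP. specialize (Hf x t Ht P HP).
  assert (Has : filterlim (fun i => (a i, s i)) F (locally (x, t))).
  { apply (filterlim_filter_le_2 (G := filter_prod (locally x) (locally t))).
    - intros Q [d Hd]. exists (ball x d) (ball t d); try apply locally_ball.
      intros y r Hy Hr. apply Hd. now split.
    - now apply filterlim_pair. }
  specialize (Has _ Hf). unfold filtermap in *. simpl in *.
  generalize (filter_and _ _ Has H0). apply filter_imp. intros i [Hi Hsi].
  now apply Hi.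
Qed.

Definition strip_nbhd (x t : R) : (R * R -> Prop) -> Prop :=
  within (fun p => 0 <= snd p) (locally (x, t)).

#[export] Instance strip_filter x t :
  Filter (strip_nbhd x t).
Proof. apply within_filter, locally_filter. Qed.

Lemma strip_fst x t :
  filterlim fst (strip_nbhd x t) (locally x).
Proof.
  apply (filterlim_filter_le_1 (F := locally (x, t))); [apply filter_le_within|].
  apply filterlim_locally. intros eps. exists eps. intros p Hp. apply Hp.
Qed.

Lemma strip_snd x t :
  filterlim snd (strip_nbhd x t) (locally t).
Proof.
  apply (filterlim_filter_le_1 (F := locally (x, t))); [apply filter_le_within|].
  apply filterlim_locally. intros eps. exists eps. intros p Hp. apply Hp.
Qed.

Lemma strip_ge0 x t :
  strip_nbhd x t (fun p => 0 <= snd p).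
Proof. unfold strip_nbhd, within. apply filter_forall. now intros p H. Qed.

Lemma continuous_on_strip_eq (T : Rbar) (f g : R -> R -> R) :
  (forall x t, in_time T t -> f x t = g x t) ->
  continuous_on_strip T f -> continuous_on_strip T g.
Proof.
  intros Hfg Hf x t Ht.
  rewrite <- Hfg by exact Ht.
  apply filterlim_ext_loc with (2 := Hf x t Ht).
  assert (HT : strip_nbhd x t (fun p => Rbar_lt (snd p) T))
    by exact (strip_snd x t _ (open_Rbar_lt T t (proj2 Ht))).
  generalize (filter_and _ _ HT (strip_ge0 x t)). apply filter_imp.
  intros p [H1 H2]. apply Hfg. split; assumption.
Qed.

Lemma continuous_on_strip_comp (T : Rbar) (phi : R -> R) (f : R -> R -> R) :
  (forall x, continuous phi x) -> continuous_on_strip T f ->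
  continuous_on_strip T (fun x t => phi (f x t)).
Proof.
  intros Hp Hf x t Ht.
  apply filterlim_comp with (1 := Hf x t Ht). apply Hp.
Qed.

Lemma continuous_on_strip_time (T : Rbar) (phi : R -> R) :
  (forall t, continuous phi t) -> continuous_on_strip T (fun _ t => phi t).
Proof.
  intros Hp x t Ht. apply filterlim_comp with (1 := strip_snd x t). apply Hp.
Qed.

Lemma continuous_on_strip_plus (T : Rbar) (f g : R -> R -> R) :
  continuous_on_strip T f -> continuous_on_strip T g ->
  continuous_on_strip T (fun x t => f x t + g x t).
Proof.
  intros Hf Hg x t Ht. now apply (filterlim_plus_R (strip_nbhd x t)); [apply Hf|apply Hg].
Qed.

Lemma continuous_on_strip_mult (T : Rbar) (f g : R -> R -> R) :
  continuous_on_strip T f -> continuous_on_strip T g ->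
  continuous_on_strip T (fun x t => f x t * g x t).
Proof.
  intros Hf Hg x t Ht. now apply (filterlim_mult_R (strip_nbhd x t)); [apply Hf|apply Hg].
Qed.

Lemma continuous_on_strip_div (T : Rbar) (f g : R -> R -> R) :
  (forall x t, in_time T t -> g x t <> 0) ->
  continuous_on_strip T f -> continuous_on_strip T g ->
  continuous_on_strip T (fun x t => f x t / g x t).
Proof.
  intros Hn Hf Hg x t Ht.
  now apply (filterlim_div_R (strip_nbhd x t)); [apply Hn|apply Hf|apply Hg].
Qed.

Lemma continuous_on_strip_opp (T : Rbar) (f : R -> R -> R) :
  continuous_on_strip T f -> continuous_on_strip T (fun x t => - f x t).
Proof.
  apply (continuous_on_strip_comp T Ropp). intros x.
  exact (filterlim_opp x).
Qed.

Lemma continuous_on_strip_minus (T : Rbar) (f g : R -> R -> R) :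
  continuous_on_strip T f -> continuous_on_strip T g ->
  continuous_on_strip T (fun x t => f x t - g x t).
Proof.
  intros Hf Hg. apply continuous_on_strip_plus; [exact Hf|].
  now apply continuous_on_strip_opp.
Qed.

Lemma continuous_along (T : Rbar) (f : R -> R -> R) (X : R -> R) (t : R) :
  continuous_on_strip T f -> in_time T t ->
  continuous (fun s => X (Rmax 0 s)) t ->
  continuous (fun s => f (X (Rmax 0 s)) (Rmax 0 s)) t.
Proof.
  intros Hf Ht HX.
  unfold continuous. rewrite (Rmax_right 0 t) by apply Ht.
  apply (filterlim_on_strip (locally t) T f (fun s => X (Rmax 0 s)) (Rmax 0));
    [exact Hf|exact Ht| | |].
  - unfold continuous in HX. now rewrite (Rmax_right 0 t) in HX by apply Ht.
  - apply filterlim_locally. intros eps. exists eps. intros s Hs.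
    rewrite <- (Rmax_right 0 t) by apply Ht.
    apply Rle_lt_trans with (1 := Rmax0_contract _ _). exact Hs.
  - apply filter_forall. intros s. apply Rmax_l.
Qed.

Lemma bounded_on_continuous (f : R -> R) (t1 : R) :
  (forall t, 0 <= t <= t1 -> continuous (fun s => f (Rmax 0 s)) t) -> bounded_on t1 f.
Proof.
  intros Hf. destruct (Rle_lt_dec 0 t1) as [H1|H1]; [|exists 0; intros t Ht; lra].
  destruct (continuity_ab_maj (fun s => Rabs (f (Rmax 0 s))) 0 t1 H1) as [M [HM _]].
  - intros t Ht. apply continuity_pt_filterlim.
    apply (continuous_comp (fun s => f (Rmax 0 s)) Rabs); [now apply Hf|].
    apply continuous_Rabs.
  - exists (Rabs (f (Rmax 0 M))). intros t Ht. specialize (HM t Ht). simpl in HM.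
    now rewrite (Rmax_right 0 t) in HM by apply Ht.
Qed.

(* The difference quotient in x, completed on the diagonal: by the mean value
   theorem it is jointly continuous wherever [fx] is. *)
Definition slope (f fx : R -> R -> R) (x y t : R) : R :=
  if Req_EM_T x y then fx x t else (f y t - f x t) / (y - x).

Lemma slope_correct (f fx : R -> R -> R) (x y t : R) :
  f y t - f x t = slope f fx x y t * (y - x).
Proof.
  unfold slope. destruct Req_EM_T as [->|H]; [ring|field; lra].
Qed.

Lemma slope_between (f fx : R -> R -> R) (x y t : R) :
  (forall z, is_derive (fun y => f y t) z (fx z t)) ->
  exists c, Rmin x y <= c <= Rmax x y /\ slope f fx x y t = fx c t.
Proof.
  intros Hd. unfold slope. destruct Req_EM_T as [->|H].
  - exists y. split; [|reflexivity]. split; [apply Rmin_l|apply Rmax_l].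
  - destruct (MVT_gen (fun y => f y t) x y (fun z => fx z t)) as [c [Hc E]].
    + intros z _. apply Hd.
    + intros z _. apply continuity_pt_filterlim, (ex_derive_continuous (fun y => f y t)).
      eexists; apply Hd.
    + exists c. split; [exact Hc|]. rewrite E. field. lra.
Qed.

(** The mean value point lies between [a i] and [b i], hence is squeezed to [x], while the time
    moves as well; joint continuity of [fx] concludes. *)
Lemma filterlim_slope {I : Type} (F : (I -> Prop) -> Prop) {FF : Filter F}
    (T : Rbar) (f fx : R -> R -> R) (a b s : I -> R) (x t : R) :
  (forall x t, in_time T t -> is_derive (fun y => f y t) x (fx x t)) ->
  continuous_on_strip T fx -> in_time T t ->
  filterlim a F (locally x) -> filterlim b F (locally x) ->
  filterlim s F (locally t) -> F (fun i => 0 <= s i) ->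
  filterlim (fun i => slope f fx (a i) (b i) (s i)) F (locally (fx x t)).
Proof.
  intros Hd Hc Ht Ha Hb Hs H0.
  assert (HT : F (fun i => Rbar_lt (s i) T))
    by exact (Hs _ (open_Rbar_lt T t (proj2 Ht))).
  apply filterlim_locally. intros eps.
  destruct (proj1 (filterlim_locally _ _) (Hc x t Ht) eps) as [d Hdd].
  assert (Ha' := proj1 (filterlim_locally _ _) Ha d).
  assert (Hb' := proj1 (filterlim_locally _ _) Hb d).
  assert (Hs' := proj1 (filterlim_locally _ _) Hs d).
  generalize (filter_and _ _ (filter_and _ _ Ha' Hb')
                (filter_and _ _ Hs' (filter_and _ _ H0 HT))).
  apply filter_imp. intros i [[H1 H2] [H3 [H4 H5]]].
  destruct (slope_between f fx (a i) (b i) (s i)) as [c [Hcc ->]].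
  - intros z. apply Hd. split; assumption.
  - apply (Hdd (c, s i)); [|exact H4]. split; [|exact H3].
    change (Rabs (a i - x) < d) in H1. change (Rabs (b i - x) < d) in H2.
    change (Rabs (c - x) < d). apply Rabs_def2 in H1, H2.
    unfold Rmin, Rmax in Hcc. destruct Rle_dec; apply Rabs_def1; lra.
Qed.

(** The increment is split at the intermediate point [(X t, t + h)]. The spatial part is a slope
    taken at the moving time, which joint continuity of [fx] controls; the other part is a
    difference quotient in time at the fixed point [X t]. *)
Lemma is_tderive_along (T : Rbar) (f fx : R -> R -> R) (X : R -> R) (t l m : R) :
  (forall x t, in_time T t -> is_derive (fun y => f y t) x (fx x t)) ->
  continuous_on_strip T fx -> in_time T t ->
  is_tderive X t l -> is_tderive (f (X t)) t m ->
  is_tderive (fun s => f (X s) s) t (fx (X t) t * l + m).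
Proof.
  intros Hd Hc Ht HX Hf.
  unfold is_tderive. fold (increments t).
  apply filterlim_ext_loc with (fun h =>
    slope f fx (X t) (X (t + h)) (t + h) * ((X (t + h) - X t) / h)
    + (f (X t) (t + h) - f (X t) t) / h).
  - generalize (increments_neq0 t). apply filter_imp. intros h Hh.
    apply Rmult_eq_reg_r with h; [|exact Hh].
    assert (E := slope_correct f fx (X t) (X (t + h)) (t + h)).
    field_simplify; [|exact Hh|exact Hh]. lra.
  - apply (filterlim_plus_R (increments t)); [|exact Hf].
    apply (filterlim_mult_R (increments t)); [|exact HX].
    apply (filterlim_slope (increments t) T); [exact Hd|exact Hc|exact Ht| | | |].
    + apply filterlim_const.
    + apply filterlim_along_increments; [apply Ht|].
      apply is_tderive_continuous with l; [apply Ht|exact HX].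
    + apply filterlim_increments.
    + apply increments_ge0.
Qed.

(** * The electric field *)

(** The two half-line integrals are [G x + q] and [q - G x], so half their difference is [G x].
    Opposite limits at the two ends single out the field among the antiderivatives of the
    density. *)
Lemma electric_field_antiderivative (rho : R -> R -> R) (t : R) (G : R -> R) (q : R) :
  (forall x, continuous (fun y => rho y t) x) ->
  (forall x, is_derive G x (rho x t)) ->
  is_lim G p_infty q -> is_lim G m_infty (- q) ->
  finite_charge (fun x => rho x t) /\ forall x, electric_field rho x t = G x.
Proof.
  intros Hc Hd Hp Hm.
  assert (HI : forall (Fa Fb : (R -> Prop) -> Prop) la lb, Filter Fa -> Filter Fb ->
    filterlim G Fa (locally la) -> filterlim G Fb (locally lb) ->
    is_RInt_gen (fun x => rho x t) Fa Fb (lb - la)).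
  { intros Fa Fb la lb HFa HFb Ha Hb.
    assert (E : forall x, Derive G x = rho x t).
    { intros x. now apply is_derive_unique. }
    apply (is_RInt_gen_ext (Derive G)).
    - apply filter_forall. intros ab x _. apply E.
    - apply is_RInt_gen_Derive; [| |exact Ha|exact Hb]; apply filter_forall; intros ab x _.
      + eexists. apply Hd.
      + apply continuous_ext with (fun x => rho x t); [|apply Hc].
        intros y. symmetry. apply E. }
  assert (Hpt : forall x, filterlim G (at_point x) (locally (G x))).
  { intros x P HP. exact (locally_singleton (G x) P HP). }
  split.
  - exists (q - - q). apply HI; [typeclasses eauto|typeclasses eauto|exact Hm|exact Hp].
  - intros x. unfold electric_field.
    rewrite (is_RInt_gen_unique _ (G x - - q)).
    2: { apply HI; [typeclasses eauto|typeclasses eauto|exact Hm|apply Hpt]. }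
    rewrite (is_RInt_gen_unique _ (q - G x)).
    2: { apply HI; [typeclasses eauto|typeclasses eauto|apply Hpt|exact Hp]. }
    lra.
Qed.

(** Convergence over the whole line is a joint condition on both endpoints. Holding one endpoint far
    out and comparing two positions of the other gives the Cauchy criterion at each end
    separately. *)
Lemma RInt_limits (f : R -> R) :
  (forall x, continuous f x) -> finite_charge f ->
  exists lp lm : R, is_lim (RInt f 0) p_infty lp /\ is_lim (RInt f 0) m_infty lm.
Proof.
  intros Hc [l Hl].
  assert (Hex : forall a b, ex_RInt f a b).
  { intros a b. apply (ex_RInt_continuous f). intros z _. apply Hc. }
  assert (Hdiff : forall a b, RInt f 0 b - RInt f 0 a = RInt f a b).
  { intros a b. rewrite <- (RInt_Chasles f 0 a b) by apply Hex.
    unfold plus. simpl. ring. }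
  assert (Htail : forall eps : posreal, exists Q P : R -> Prop,
    Rbar_locally m_infty Q /\ Rbar_locally p_infty P /\
    forall a b, Q a -> P b -> Rabs (RInt f 0 b - RInt f 0 a - l) < eps / 2).
  { intros eps.
    destruct (Hl (ball l (pos_div_2 eps))) as [Q P HQ HP H]; [apply locally_ball|].
    exists Q, P. split; [exact HQ|]. split; [exact HP|].
    intros a b Ha Hb. destruct (H a b Ha Hb) as [y [Hy Hb']].
    rewrite Hdiff. simpl in Hy. rewrite (is_RInt_unique f a b y Hy). exact Hb'. }
  destruct (proj1 (filterlim_locally_cauchy (F := Rbar_locally p_infty) (RInt f 0)))
    as [lp Hp].
  { intros eps. destruct (Htail eps) as [Q [P [HQ [HP H]]]].
    exists P. split; [exact HP|]. intros u v Hu Hv.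
    destruct (filter_ex (F := Rbar_locally m_infty) Q HQ) as [a Ha].
    assert (H1 := H a u Ha Hu). assert (H2 := H a v Ha Hv).
    change (Rabs (RInt f 0 v - RInt f 0 u) < eps).
    apply Rabs_def2 in H1, H2. apply Rabs_def1; lra. }
  destruct (proj1 (filterlim_locally_cauchy (F := Rbar_locally m_infty) (RInt f 0)))
    as [lm Hm].
  { intros eps. destruct (Htail eps) as [Q [P [HQ [HP H]]]].
    exists Q. split; [exact HQ|]. intros u v Hu Hv.
    destruct (filter_ex (F := Rbar_locally p_infty) P HP) as [b Hb].
    assert (H1 := H u b Hu Hb). assert (H2 := H v b Hv Hb).
    change (Rabs (RInt f 0 v - RInt f 0 u) < eps).
    apply Rabs_def2 in H1, H2. apply Rabs_def1; lra. }
  exists lp, lm. split; [exact Hp|exact Hm].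
Qed.

Lemma electric_field_correct (rho : R -> R -> R) (t : R) :
  (forall x, continuous (fun y => rho y t) x) -> finite_charge (fun x => rho x t) ->
  (forall x, is_derive (fun y => electric_field rho y t) x (rho x t)) /\
  exists q : R, is_lim (fun y => electric_field rho y t) p_infty q /\
                is_lim (fun y => electric_field rho y t) m_infty (- q).
Proof.
  intros Hc Hf. destruct (RInt_limits _ Hc Hf) as [lp [lm [Hp Hm]]].
  set (P := RInt (fun x => rho x t) 0) in *.
  (* Subtracting the mean of the two limits makes them opposite, equal to plus and minus half the
     total charge. *)
  assert (HdP : forall x, is_derive (fun x => P x - (lp + lm) / 2) x (rho x t)).
  { intros x. replace (rho x t) with (minus (rho x t) 0) by (unfold minus, plus, opp; simpl; ring).
    apply (is_derive_minus P (fun _ => (lp + lm) / 2)); [|exact (is_derive_const ((lp + lm) / 2) x)].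
    apply (is_derive_RInt (fun x => rho x t) P 0 x); [|apply Hc].
    apply filter_forall. intros b. apply (RInt_correct (fun x => rho x t)).
    apply (ex_RInt_continuous (fun x => rho x t)). intros z _. apply Hc. }
  assert (Hshift : forall (x : Rbar) (l : R), is_lim P x l ->
            is_lim (fun x => P x - (lp + lm) / 2) x (l - (lp + lm) / 2)).
  { intros x l H. apply (is_lim_minus P (fun _ => (lp + lm) / 2) x l ((lp + lm) / 2));
      [exact H|apply is_lim_const|reflexivity]. }
  destruct (electric_field_antiderivative rho t _ ((lp - lm) / 2) Hc HdP) as [_ E].
  - replace ((lp - lm) / 2) with (lp - (lp + lm) / 2) by field. now apply Hshift.
  - replace (- ((lp - lm) / 2)) with (lm - (lp + lm) / 2) by field. now apply Hshift.
  - split.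
    + intros x. apply is_derive_ext with (2 := HdP x). intros y. symmetry. apply E.
    + exists ((lp - lm) / 2). split.
      * apply is_lim_ext with (fun x => P x - (lp + lm) / 2); [intros y; symmetry; apply E|].
        replace ((lp - lm) / 2) with (lp - (lp + lm) / 2) by field. now apply Hshift.
      * apply is_lim_ext with (fun x => P x - (lp + lm) / 2); [intros y; symmetry; apply E|].
        replace (- ((lp - lm) / 2)) with (lm - (lp + lm) / 2) by field. now apply Hshift.
Qed.

(** * The free flow *)

Definition flow (k : R) (u0 E0 : R -> R) (a t : R) : R :=
  a + u0 a * t + k / 2 * E0 a * t ^ 2.

Definition velocity (k : R) (u0 E0 : R -> R) (a t : R) : R := u0 a + k * E0 a * t.

(** Both the label derivative of [velocity] and the time derivative of [Gamma]; it becomes the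
    numerator of [u_x]. *)
Definition velocity_a (k : R) (rho0 u0 : R -> R) (a t : R) : R :=
  Derive u0 a + k * rho0 a * t.

Lemma derive_nonneg_incr (f df : R -> R) (x y : R) :
  (forall z, is_derive f z (df z)) -> (forall z, 0 <= df z) -> x <= y -> f x <= f y.
Proof.
  intros Hd Hp Hxy. destruct (MVT_gen f x y df) as [c [_ E]].
  - intros z _. apply Hd.
  - intros z _. apply continuity_pt_filterlim, (ex_derive_continuous f).
    eexists; apply Hd.
  - assert (0 <= df c * (y - x)) by (apply Rmult_le_pos; [apply Hp|lra]). lra.
Qed.

Lemma derive_pos_incr (f df : R -> R) (x y : R) :
  (forall z, is_derive f z (df z)) -> (forall z, 0 < df z) -> x < y -> f x < f y.
Proof.
  intros Hd Hp Hxy. destruct (MVT_gen f x y df) as [c [_ E]].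
  - intros z _. apply Hd.
  - intros z _. apply continuity_pt_filterlim, (ex_derive_continuous f).
    eexists; apply Hd.
  - assert (0 < df c * (y - x)) by (apply Rmult_lt_0_compat; [apply Hp|lra]). lra.
Qed.

Lemma in_time_above (T : Rbar) (t : R) :
  in_time T t -> exists t', t < t' /\ in_time T t'.
Proof.
  intros [H0 HT]. destruct T as [T| |]; simpl in HT.
  - exists ((t + T) / 2). split; [lra|]. split; [lra|]. simpl. lra.
  - exists (t + 1). split; [lra|]. split; [lra|]. exact I.
  - contradiction.
Qed.

Lemma is_derive_quotient (f : R -> R) (x l : R) :
  filterlim (fun h => (f (x + h) - f x) / h)
    (within (fun h => h <> 0) (locally 0)) (locally l) ->
  is_derive f x l.
Proof.
  intros H. apply is_derive_Reals. intros eps Heps.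
  destruct (proj1 (filterlim_locally _ _) H (mkposreal eps Heps)) as [d Hd].
  exists d. intros h Hh0 Hh. apply Hd; [|exact Hh0].
  change (Rabs (h - 0) < d). now rewrite Rminus_0_r.
Qed.

Lemma continuous_on_strip_space (T : Rbar) (phi : R -> R) :
  (forall x, continuous phi x) -> continuous_on_strip T (fun x _ => phi x).
Proof.
  intros Hp x t Ht. apply filterlim_comp with (1 := strip_fst x t). apply Hp.
Qed.

Section Flow.

Variables (k q : R) (rho0 u0 E0 : R -> R).
Hypothesis hk : 0 < k.
Hypothesis hrho0 : C1 rho0.
Hypothesis hu0 : C1 u0.
Hypothesis hE0 : forall a, is_derive E0 a (rho0 a).
Hypothesis hE0p : is_lim E0 p_infty q.
Hypothesis hE0m : is_lim E0 m_infty (- q).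

Lemma is_derive_flow_label a t :
  is_derive (fun a => flow k u0 E0 a t) a (Gamma k rho0 u0 a t).
Proof.
  unfold flow, Gamma.
  auto_derive.
  - split; [apply hu0|]. split; [now exists (rho0 a)|trivial].
  - rewrite (is_derive_unique (fun a : R => E0 a) a (rho0 a)) by apply hE0.
    change (Derive (fun x : R => u0 x) a) with (Derive u0 a). ring.
Qed.

Lemma is_derive_flow_time a t : is_derive (flow k u0 E0 a) t (velocity k u0 E0 a t).
Proof.
  unfold flow, velocity. auto_derive; [trivial|]. field.
Qed.

Lemma is_derive_velocity_label a t :
  is_derive (fun a => velocity k u0 E0 a t) a (velocity_a k rho0 u0 a t).
Proof.
  unfold velocity, velocity_a.
  auto_derive.
  - split; [apply hu0|]. split; [now exists (rho0 a)|trivial].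
  - rewrite (is_derive_unique (fun a : R => E0 a) a (rho0 a)) by apply hE0.
    change (Derive (fun x : R => u0 x) a) with (Derive u0 a). ring.
Qed.

Lemma is_derive_velocity_time a t : is_derive (velocity k u0 E0 a) t (k * E0 a).
Proof.
  unfold velocity. auto_derive; [trivial|]. ring.
Qed.

Lemma is_derive_Gamma_time a t :
  is_derive (Gamma k rho0 u0 a) t (velocity_a k rho0 u0 a t).
Proof.
  unfold Gamma, velocity_a. auto_derive; [trivial|]. field.
Qed.

Lemma continuous_on_strip_Gamma T : continuous_on_strip T (Gamma k rho0 u0).
Proof.
  apply continuous_on_strip_plus.
  - apply (continuous_on_strip_plus T (fun _ _ => 1)).
    + apply (continuous_on_strip_time T (fun _ => 1)). intros t. apply continuous_const.
    + apply continuous_on_strip_mult.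
      * apply continuous_on_strip_space, hu0.
      * apply (continuous_on_strip_time T (fun t => t)). intros t. apply continuous_id.
  - apply (continuous_on_strip_mult T (fun x _ => k / 2 * rho0 x)).
    + apply (continuous_on_strip_space T (fun x => k / 2 * rho0 x)). intros x.
      apply (continuous_mult (fun _ => k / 2) rho0); [apply continuous_const|].
      apply (ex_derive_continuous rho0), hrho0.
    + apply (continuous_on_strip_time T (fun t => t ^ 2)). intros t.
      apply (ex_derive_continuous (fun t => t ^ 2)). auto_derive. trivial.
Qed.

Lemma continuous_on_strip_affine T (f g : R -> R) :
  (forall x, continuous f x) -> (forall x, continuous g x) ->
  continuous_on_strip T (fun x t => f x + k * g x * t).
Proof.
  intros Hf Hg. apply (continuous_on_strip_plus T (fun x _ => f x)).
  - now apply continuous_on_strip_space.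
  - apply (continuous_on_strip_mult T (fun x _ => k * g x)).
    + apply (continuous_on_strip_space T (fun x => k * g x)). intros x.
      apply (continuous_mult (fun _ => k) g); [apply continuous_const|apply Hg].
    + apply (continuous_on_strip_time T (fun t => t)). intros t. apply continuous_id.
Qed.

Lemma continuous_E0 a : continuous E0 a.
Proof. apply (ex_derive_continuous E0). eexists. apply hE0. Qed.

Lemma continuous_on_strip_velocity T : continuous_on_strip T (velocity k u0 E0).
Proof.
  apply continuous_on_strip_affine; [|apply continuous_E0].
  intros x. apply (ex_derive_continuous u0), hu0.
Qed.

Lemma continuous_on_strip_velocity_a T : continuous_on_strip T (velocity_a k rho0 u0).
Proof.
  apply continuous_on_strip_affine; [apply hu0|].
  intros x. apply (ex_derive_continuous rho0), hrho0.
Qed.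

(* Since E0 is bounded, the flow at time [t] is, up to a bounded term, a convex
   combination of the nondecreasing flow at time [t'] and of the identity. *)
Lemma flow_interpolation a t t' :
  0 < t' -> flow k u0 E0 a t =
    t / t' * flow k u0 E0 a t' + (1 - t / t') * a - k / 2 * t * (t' - t) * E0 a.
Proof. intros H. unfold flow. field. lra. Qed.

(** In the interpolation the flow at [t'] is monotone, so it is bounded on the useful side by its
    value at label 0, and [E0] is bounded near each end; the term [(1 - s) * a] with [s < 1]
    dominates. The later time matters: positivity of [Gamma] at time [t] alone would allow the flow
    to have a bounded image. *)
Lemma flow_limits t t' :
  0 <= t < t' -> (forall a, 0 <= Gamma k rho0 u0 a t') ->
  is_lim (fun a => flow k u0 E0 a t) p_infty p_infty /\
  is_lim (fun a => flow k u0 E0 a t) m_infty m_infty.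
Proof.
  intros Ht HG.
  set (s := t / t'). set (c := k / 2 * t * (t' - t)).
  assert (Hs : 0 <= s < 1).
  { unfold s. split; [apply Rdiv_le_0_compat; lra|].
    apply Rmult_lt_reg_r with t'; [lra|]. field_simplify; lra. }
  assert (Hc : 0 <= c) by (unfold c; apply Rmult_le_pos; [apply Rmult_le_pos|]; lra).
  assert (Hf : forall a, flow k u0 E0 a t =
             s * flow k u0 E0 a t' + (1 - s) * a - c * E0 a).
  { intros a. apply flow_interpolation. lra. }
  assert (Hmono : forall a b, a <= b -> s * flow k u0 E0 a t' <= s * flow k u0 E0 b t').
  { intros a b Hab. apply Rmult_le_compat_l; [lra|].
    apply (derive_nonneg_incr (fun a => flow k u0 E0 a t')
             (fun a => Gamma k rho0 u0 a t') a b); [|exact HG|exact Hab].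
    intros z. apply is_derive_flow_label. }
  set (F := s * flow k u0 E0 0 t').
  split; apply is_lim_spec; intros M.
  - apply is_lim_spec in hE0p. destruct (hE0p (mkposreal 1 Rlt_0_1)) as [N HN].
    (* Past 0 the monotone term is at least [F], past [N] the field is below [q + 1], and the last
       bound solves [F + (1 - s) * a - c * (q + 1) > M] for [a]. *)
    simpl in HN. exists (Rmax (Rmax 0 N) ((M - F + c * (q + 1)) / (1 - s))).
    intros a Ha. apply Rmax_Rlt in Ha. destruct Ha as [Ha Ha3].
    apply Rmax_Rlt in Ha. destruct Ha as [Ha1 Ha2].
    specialize (HN a Ha2). apply Rabs_def2 in HN.
    assert (H1 := Hmono 0 a ltac:(lra)). fold F in H1.
    assert (H2 : c * E0 a <= c * (q + 1)) by (apply Rmult_le_compat_l; lra).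
    assert (H3 : M - F + c * (q + 1) < a * (1 - s)) by (apply Rlt_div_l; lra).
    rewrite Hf. lra.
  - apply is_lim_spec in hE0m. destruct (hE0m (mkposreal 1 Rlt_0_1)) as [N HN].
    simpl in HN. exists (Rmin (Rmin 0 N) ((M - F - c * (q + 1)) / (1 - s))).
    intros a Ha. apply Rmin_Rgt in Ha. destruct Ha as [Ha Ha3].
    apply Rmin_Rgt in Ha. destruct Ha as [Ha1 Ha2].
    specialize (HN a Ha2). apply Rabs_def2 in HN.
    assert (H1 := Hmono a 0 ltac:(lra)). fold F in H1.
    assert (H2 : c * - (q + 1) <= c * E0 a) by (apply Rmult_le_compat_l; lra).
    assert (H3 : a * (1 - s) < M - F - c * (q + 1)) by (apply Rlt_div_r; lra).
    rewrite Hf. lra.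
Qed.

(** * Inverting the flow while [Gamma] is positive *)

Variable T : Rbar.
Hypothesis hGamma : forall a t, in_time T t -> 0 < Gamma k rho0 u0 a t.

Lemma flow_incr a b t : in_time T t -> a < b -> flow k u0 E0 a t < flow k u0 E0 b t.
Proof.
  intros Ht. apply (derive_pos_incr (fun a => flow k u0 E0 a t)
    (fun a => Gamma k rho0 u0 a t)).
  - intros z. apply is_derive_flow_label.
  - intros z. now apply hGamma.
Qed.

Lemma flow_inj a b t : in_time T t -> flow k u0 E0 a t = flow k u0 E0 b t -> a = b.
Proof.
  intros Ht E. destruct (Rtotal_order a b) as [H|[H|H]]; [|exact H|];
    apply (flow_incr _ _ t Ht) in H; lra.
Qed.

Lemma flow_limits_strip t :
  in_time T t ->
  is_lim (fun a => flow k u0 E0 a t) p_infty p_infty /\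
  is_lim (fun a => flow k u0 E0 a t) m_infty m_infty.
Proof.
  intros Ht. destruct (in_time_above T t Ht) as [t' [H1 H2]].
  apply flow_limits with t'; [split; [apply Ht|exact H1]|].
  intros a. now apply Rlt_le, hGamma.
Qed.

Lemma exists_inverse_flow :
  exists A : R -> R -> R, forall x t, in_time T t -> flow k u0 E0 (A x t) t = x.
Proof.
  (* Any preimage will do, since labels are unique within the strip; outside the strip the value is
     arbitrary. *)
  exists (fun x t => epsilon (inhabits 0) (fun a => flow k u0 E0 a t = x)).
  intros x t Ht. apply (epsilon_spec (inhabits 0) (fun a => flow k u0 E0 a t = x)).
  destruct (flow_limits_strip t Ht) as [Hp Hm].
  destruct (IVT_Rbar_incr (fun a => flow k u0 E0 a t) m_infty p_infty m_infty p_infty x)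
    as [a [_ [_ E]]]; simpl; trivial.
  - intros a _ _. apply continuity_pt_filterlim.
    apply (ex_derive_continuous (fun a => flow k u0 E0 a t)).
    eexists. apply is_derive_flow_label.
  - now split.
  - now exists a.
Qed.

Variable A : R -> R -> R.
Hypothesis hA : forall x t, in_time T t -> flow k u0 E0 (A x t) t = x.

Lemma inverse_flow_lt a x t : in_time T t -> flow k u0 E0 a t < x -> a < A x t.
Proof.
  intros Ht H. destruct (Rtotal_order a (A x t)) as [E|[E|E]]; [exact E| |].
  - rewrite E, hA in H by exact Ht. lra.
  - apply (flow_incr _ _ t Ht) in E. rewrite hA in E by exact Ht. lra.
Qed.

Lemma inverse_flow_gt a x t : in_time T t -> x < flow k u0 E0 a t -> A x t < a.
Proof.
  intros Ht H. destruct (Rtotal_order a (A x t)) as [E|[E|E]]; [| |exact E].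
  - apply (flow_incr _ _ t Ht) in E. rewrite hA in E by exact Ht. lra.
  - rewrite E, hA in H by exact Ht. lra.
Qed.

Lemma inverse_flow_limits t :
  in_time T t ->
  is_lim (fun x => A x t) p_infty p_infty /\ is_lim (fun x => A x t) m_infty m_infty.
Proof.
  intros Ht. split; apply is_lim_spec; intros M; exists (flow k u0 E0 M t); intros x Hx.
  - now apply inverse_flow_lt.
  - now apply inverse_flow_gt.
Qed.

(** An order argument: [x] lies strictly between the flows of the labels [a - eps] and [a + eps].
    For these two fixed labels the strict inequalities persist at nearby points and times, and
    monotonicity traps the inverse between the labels. *)
Lemma continuous_on_strip_inverse_flow : continuous_on_strip T A.
Proof.
  intros x t Ht. apply filterlim_locally. intros eps.
  set (a := A x t).
  assert (HT : strip_nbhd x t (fun p => Rbar_lt (snd p) T))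
    by exact (strip_snd x t _ (open_Rbar_lt T t (proj2 Ht))).
  assert (Hlim : forall b, filterlim (fun p => fst p - flow k u0 E0 b (snd p))
            (strip_nbhd x t) (locally (x - flow k u0 E0 b t))).
  { intros b. apply (filterlim_plus_R (strip_nbhd x t)); [apply strip_fst|].
    apply (filterlim_comp _ _ _ snd (fun s => - flow k u0 E0 b s) _ (locally t));
      [apply strip_snd|].
    apply (continuous_opp (flow k u0 E0 b)), (ex_derive_continuous (flow k u0 E0 b)).
    eexists. apply is_derive_flow_time. }
  assert (Hx : flow k u0 E0 a t = x) by now apply hA.
  assert (He := cond_pos eps).
  assert (H1 := flow_incr (a - eps) a t Ht ltac:(lra)).
  assert (H2 := flow_incr a (a + eps) t Ht ltac:(lra)).
  assert (L1 : strip_nbhd x t (fun p => 0 < fst p - flow k u0 E0 (a - eps) (snd p))).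
  { apply (Hlim (a - eps) (fun y => 0 < y)), (open_gt 0). lra. }
  assert (L2 : strip_nbhd x t (fun p => fst p - flow k u0 E0 (a + eps) (snd p) < 0)).
  { apply (Hlim (a + eps) (fun y => y < 0)), (open_lt 0). lra. }
  generalize (filter_and _ _ (filter_and _ _ HT (strip_ge0 x t)) (filter_and _ _ L1 L2)).
  apply filter_imp. intros [y s] [[H3 H4] [H5 H6]]. simpl in *.
  assert (Hs : in_time T s) by (split; assumption).
  assert (a - eps < A y s) by (apply inverse_flow_lt; [exact Hs|lra]).
  assert (A y s < a + eps) by (apply inverse_flow_gt; [exact Hs|lra]).
  change (Rabs (A y s - a) < eps). apply Rabs_def1; lra.
Qed.

Lemma continuous_on_strip_comp_inverse (phi : R -> R -> R) :
  continuous_on_strip T phi -> continuous_on_strip T (fun x t => phi (A x t) t).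
Proof.
  intros Hp x t Ht.
  apply (filterlim_on_strip (strip_nbhd x t) T phi (fun p => A (fst p) (snd p)) snd);
    [exact Hp|exact Ht| |apply strip_snd|apply strip_ge0].
  now apply continuous_on_strip_inverse_flow.
Qed.

(** The slope of the flow between the labels of [x] and [x + h], times the increment of the label,
    equals [h]; the difference quotient of [A] is therefore the inverse of a slope tending to
    [Gamma]. *)
Lemma is_derive_inverse_flow x t :
  in_time T t -> is_derive (fun y => A y t) x (/ Gamma k rho0 u0 (A x t) t).
Proof.
  intros Ht. apply is_derive_quotient.
  set (F := within (fun h => h <> 0) (locally 0)).
  assert (FF : Filter F) by (apply within_filter, locally_filter).
  set (sl := fun h => slope (flow k u0 E0) (Gamma k rho0 u0) (A x t) (A (x + h) t) t).
  assert (Hsl : filterlim sl F (locally (Gamma k rho0 u0 (A x t) t))).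
  { apply (filterlim_slope F T); [|apply continuous_on_strip_Gamma|exact Ht| | | |].
    - intros y s _. apply is_derive_flow_label.
    - apply filterlim_const.
    - apply (filterlim_comp _ _ _ (fun h => x + h) (fun y => A y t) _ (locally x)).
      + apply (filterlim_filter_le_1 (F := locally 0)); [apply filter_le_within|].
        replace (locally x) with (locally (x + 0)) by now rewrite Rplus_0_r.
        apply (continuous_plus (fun _ => x) (fun h => h));
          [apply continuous_const|apply continuous_id].
      + apply (continuous_on_strip_x T); [|exact Ht].
        apply continuous_on_strip_inverse_flow.
    - apply filterlim_const.
    - apply filter_forall. intros _. apply Ht. }
  assert (HG := hGamma (A x t) t Ht).
  replace (/ Gamma k rho0 u0 (A x t) t) with (1 / Gamma k rho0 u0 (A x t) t) by (field; lra).
  apply filterlim_ext_loc with (fun h => 1 / sl h).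
  - unfold F, within. apply filter_forall. intros h Hh.
    assert (E := slope_correct (flow k u0 E0) (Gamma k rho0 u0) (A x t) (A (x + h) t) t).
    fold (sl h) in E. rewrite !hA in E by exact Ht.
    assert (sl h <> 0) by (intros H0; rewrite H0 in E; lra).
    replace (A (x + h) t - A x t) with (h / sl h); [field; now split|].
    apply Rmult_eq_reg_l with (sl h); [|assumption]. field_simplify; [lra|assumption].
  - apply (filterlim_div_R F); [lra|apply filterlim_const|exact Hsl].
Qed.

(** At a fixed position the displacement due to the change of label cancels the one due to time:
    slope times label increment plus [v h * h] is zero. *)
Lemma is_tderive_inverse_flow x t :
  in_time T t ->
  is_tderive (A x) t (- velocity k u0 E0 (A x t) t / Gamma k rho0 u0 (A x t) t).
Proof.
  intros Ht. unfold is_tderive. fold (increments t).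
  set (sl := fun h =>
    slope (flow k u0 E0) (Gamma k rho0 u0) (A x t) (A x (t + h)) (t + h)).
  assert (Hsl : filterlim sl (increments t) (locally (Gamma k rho0 u0 (A x t) t))).
  { apply (filterlim_slope (increments t) T);
      [|apply continuous_on_strip_Gamma|exact Ht| | | |].
    - intros y s _. apply is_derive_flow_label.
    - apply filterlim_const.
    - apply (filterlim_on_strip (increments t) T A (fun _ => x) (fun h => t + h));
        [apply continuous_on_strip_inverse_flow|exact Ht|apply filterlim_const| |].
      + apply filterlim_increments.
      + apply increments_ge0.
    - apply filterlim_increments.
    - apply increments_ge0. }
  assert (HG := hGamma (A x t) t Ht).
  set (v := fun h => (flow k u0 E0 (A x t) (t + h) - flow k u0 E0 (A x t) t) / h).
  assert (Hv : filterlim v (increments t) (locally (velocity k u0 E0 (A x t) t)))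
    by exact (is_derive_is_tderive _ _ _ (is_derive_flow_time (A x t) t)).
  assert (HT : increments t (fun h => Rbar_lt (t + h) T))
    by exact (filterlim_increments t _ (open_Rbar_lt T t (proj2 Ht))).
  (* The label increment may vanish here, so the slope is nonzero not by the identity but because
     its limit [Gamma] is positive. *)
  assert (Hpos : increments t (fun h => 0 < sl h)) by exact (Hsl _ (open_gt 0 _ HG)).
  apply filterlim_ext_loc with (fun h => - v h / sl h).
  - generalize (filter_and _ _ (filter_and _ _ HT Hpos)
      (filter_and _ _ (increments_ge0 t) (increments_neq0 t))).
    apply filter_imp. intros h [[H1 H2] [H3 H4]].
    assert (Hs : in_time T (t + h)) by (split; assumption).
    assert (E := slope_correct (flow k u0 E0) (Gamma k rho0 u0)
                   (A x t) (A x (t + h)) (t + h)).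
    fold (sl h) in E. rewrite hA in E by exact Hs.
    assert (Ev : v h * h = flow k u0 E0 (A x t) (t + h) - x).
    { unfold v. rewrite (hA x t Ht). field. exact H4. }
    replace (A x (t + h) - A x t) with (- v h * h / sl h); [field; lra|].
    apply Rmult_eq_reg_l with (sl h); [|lra]. field_simplify; [lra|lra].
  - apply (filterlim_div_R (increments t)); [lra| |exact Hsl].
    apply filterlim_comp with (1 := Hv). exact (filterlim_opp _).
Qed.

(** The composite of [E0] with the inverse flow is an antiderivative of the proposed density, and it
    keeps the limits [q] and [- q] because labels tend to infinity with position. It is therefore
    the electric field, and the force on a particle is the [k * E0] built into the parabolas. *)
Lemma solution_exists :
  Rbar_lt 0 T ->
  exists rho u, classical_solution k rho0 u0 T rho u.
Proof.
  intros HT. set (G := fun x t => Gamma k rho0 u0 (A x t) t).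
  set (rho := fun x t => rho0 (A x t) / G x t).
  set (u := fun x t => velocity k u0 E0 (A x t) t).
  set (ux := fun x t => velocity_a k rho0 u0 (A x t) t / G x t).
  assert (HG : forall x t, in_time T t -> 0 < G x t) by (intros x t; apply hGamma).
  assert (cG : continuous_on_strip T G)
    by apply continuous_on_strip_comp_inverse, continuous_on_strip_Gamma.
  assert (crho : continuous_on_strip T rho).
  { apply continuous_on_strip_div; [|apply (continuous_on_strip_comp T rho0)|exact cG].
    - intros x t Ht. apply Rgt_not_eq, HG, Ht.
    - intros x. apply (ex_derive_continuous rho0), hrho0.
    - apply continuous_on_strip_inverse_flow. }
  assert (cu : continuous_on_strip T u)
    by apply continuous_on_strip_comp_inverse, continuous_on_strip_velocity.
  assert (cux : continuous_on_strip T ux).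
  { apply continuous_on_strip_div; [|apply continuous_on_strip_comp_inverse|exact cG].
    - intros x t Ht. apply Rgt_not_eq, HG, Ht.
    - apply continuous_on_strip_velocity_a. }
  assert (cE : continuous_on_strip T (fun x t => k * E0 (A x t))).
  { apply (continuous_on_strip_comp T (fun a => k * E0 a) A);
      [|apply continuous_on_strip_inverse_flow].
    intros x. apply (continuous_mult (fun _ => k) E0);
      [apply continuous_const|apply continuous_E0]. }
  assert (dE : forall t, in_time T t -> forall x,
             is_derive (fun y => E0 (A y t)) x (rho x t)).
  { intros t Ht x. unfold rho, G, Rdiv. rewrite Rmult_comm.
    apply (is_derive_comp E0 (fun y => A y t)); [apply hE0|].
    now apply is_derive_inverse_flow. }
  assert (crx : forall t, in_time T t -> forall x, continuous (fun y => rho y t) x).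
  { intros t Ht x. now apply (continuous_on_strip_x T). }
  assert (HE : forall t, in_time T t -> finite_charge (fun x => rho x t) /\
             forall x, electric_field rho x t = E0 (A x t)).
  { intros t Ht. destruct (inverse_flow_limits t Ht) as [Hp Hm].
    apply (electric_field_antiderivative rho t (fun x => E0 (A x t)) q); auto.
    - apply (is_lim_comp E0 (fun x => A x t) p_infty q p_infty); trivial.
      exists 0. intros y _. discriminate.
    - apply (is_lim_comp E0 (fun x => A x t) m_infty (- q) m_infty); trivial.
      exists 0. intros y _. discriminate. }
  assert (HA0 : forall x, A x 0 = x).
  { intros x. rewrite <- (hA x 0) at 2 by (split; [lra|exact HT]). unfold flow. ring. }
  exists rho, u. split.
  - exact crho.
  - intros t Ht. now apply HE.
  - intros a b t Ht.
    (* The charge between two positions is the difference of [E0] at their labels, so its rate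
       follows from the time derivative of [A]. *)
    apply (is_tderive_ext_strip T (fun s => E0 (A b s) - E0 (A a s))); [exact Ht| |].
    + intros s Hs. symmetry. apply is_RInt_unique.
      apply (is_RInt_derive (fun y => E0 (A y s))).
      * intros x _. now apply dE.
      * intros x _. now apply crx.
    + replace (rho a t * u a t - rho b t * u b t) with
        (rho0 (A b t) * (- velocity k u0 E0 (A b t) t / Gamma k rho0 u0 (A b t) t)
         - rho0 (A a t) * (- velocity k u0 E0 (A a t) t / Gamma k rho0 u0 (A a t) t)).
      * apply is_tderive_minus; [apply Ht| |];
          (apply (is_tderive_comp E0); [apply Ht|apply hE0|now apply is_tderive_inverse_flow]).
      * assert (H1 := HG a t Ht). assert (H2 := HG b t Ht). unfold rho, u, G in *.
        field. split; lra.
  (* The time derivative is read off from the momentum equation; the chain rule along [A x] confirms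
     it. *)
  - exists ux, (fun x t => k * E0 (A x t) - u x t * ux x t). split.
    + split; [|split; [exact cu|split; [exact cux|]]].
      * intros x t Ht. assert (H1 := HG x t Ht). split.
        -- unfold ux, G, Rdiv. rewrite Rmult_comm.
           apply (is_derive_comp (fun a => velocity k u0 E0 a t) (fun y => A y t)).
           ++ apply is_derive_velocity_label.
           ++ now apply is_derive_inverse_flow.
        -- replace (k * E0 (A x t) - u x t * ux x t) with
             (velocity_a k rho0 u0 (A x t) t *
              (- velocity k u0 E0 (A x t) t / Gamma k rho0 u0 (A x t) t) + k * E0 (A x t)).
           ++ apply (is_tderive_along T (velocity k u0 E0) (velocity_a k rho0 u0) (A x));
                [|apply continuous_on_strip_velocity_a|exact Ht| |].
              ** intros a s _. apply is_derive_velocity_label.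
              ** now apply is_tderive_inverse_flow.
              ** apply is_derive_is_tderive, is_derive_velocity_time.
           ++ unfold u, ux, G in *. field. lra.
      * apply continuous_on_strip_minus; [exact cE|].
        now apply continuous_on_strip_mult.
    + intros x t Ht. rewrite (proj2 (HE t Ht)). ring.
  - intros x t Ht. apply is_derive_ext with (2 := dE t Ht x).
    intros y. symmetry. now apply HE.
  - intros x. unfold rho, G. rewrite HA0. unfold Gamma. field.
  - intros x. unfold u. rewrite HA0. unfold velocity. ring.
Qed.

End Flow.

(** * Uniqueness *)

Section Uniqueness.

Variables (k q : R) (rho0 u0 E0 : R -> R).
Hypothesis hk : 0 < k.
Hypothesis hrho0_pos : forall a, 0 < rho0 a.
Hypothesis hrho0 : C1 rho0.
Hypothesis hu0 : C1 u0.
Hypothesis hE0 : forall a, is_derive E0 a (rho0 a).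
Hypothesis hE0p : is_lim E0 p_infty q.
Hypothesis hE0m : is_lim E0 m_infty (- q).
Variables (T : Rbar) (rho u : R -> R -> R).
Hypothesis hsol : classical_solution k rho0 u0 T rho u.

Lemma in_time_0 t : in_time T t -> in_time T 0.
Proof. intros Ht. apply in_time_le with t; [exact Ht|split; [lra|apply Ht]]. Qed.

Lemma electric_field_0 x : in_time T 0 -> electric_field rho x 0 = E0 x.
Proof.
  intros H0. apply (electric_field_antiderivative rho 0 E0 q); [| |exact hE0p|exact hE0m].
  - intros y. apply (continuous_on_strip_x T); [apply hsol|exact H0].
  - intros y. rewrite (sol_rho_init _ _ _ _ _ _ hsol). apply hE0.
Qed.

(** Joint continuity is not visible from the improper integrals, but the momentum equation writes
    the field as [(u_t + u u_x) / k], which is continuous. *)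
Lemma continuous_on_strip_electric_field : continuous_on_strip T (electric_field rho).
Proof.
  destruct (sol_momentum _ _ _ _ _ _ hsol) as [ux [ut [[_ [cu [cux cut]]] Hm]]].
  apply continuous_on_strip_eq with (fun x t => / k * (ut x t + u x t * ux x t)).
  - intros x t Ht. rewrite Hm by exact Ht. field. lra.
  - apply (continuous_on_strip_comp T (fun y => / k * y)).
    + intros y. apply (continuous_mult (fun _ => / k) (fun y => y));
        [apply continuous_const|apply continuous_id].
    + apply continuous_on_strip_plus; [exact cut|]. now apply continuous_on_strip_mult.
Qed.

(* Mass conservation only controls increments of the electric field in space,
   which leaves an unknown function of time [g], and an unknown drift [F] of
   the characteristics with [F'' = k g]. The electric field minus [g] is a
   stream function of the mass, with derivatives [rho] and [- rho u]. *)
Lemma exists_stream_function :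
  exists g, g 0 = 0 /\
    (forall t, in_time T t -> continuous (fun s => g (Rmax 0 s)) t) /\
    forall x t, in_time T t ->
      is_tderive (fun s => electric_field rho x s - g s) t (- (rho x t * u x t)).
Proof.
  destruct (sol_momentum _ _ _ _ _ _ hsol) as [ux [ut [[_ [cu _]] _]]].
  assert (H0c : forall t, continuous (fun s => (fun _ => 0) (Rmax 0 s)) t)
    by (intros t; apply (continuous_const (0 : R))).
  (* [W] is the charge that has crossed the origin since time 0. *)
  destruct (exists_antiderivative T (fun s => rho 0 s * u 0 s)) as [W [W0 HW]].
  { intros t Ht.
    apply (continuous_along T (fun x t => rho x t * u x t) (fun _ => 0));
      [|exact Ht|apply H0c].
    apply continuous_on_strip_mult; [apply hsol|exact cu]. }
  set (e0 := electric_field rho 0 0).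
  (* With this choice the field at [x] minus [g] is the charge between 0 and [x] minus [W] plus a
     constant; in its time derivative the fluxes at the origin cancel and only the one at [x] is
     left. *)
  exists (fun t => electric_field rho 0 t + (W t - e0)).
  split; [rewrite W0; unfold e0; ring|]. split.
  - intros t Ht.
    apply (continuous_plus (fun s => electric_field rho 0 (Rmax 0 s))
                           (fun s => W (Rmax 0 s) - e0)).
    + apply (continuous_along T (electric_field rho) (fun _ => 0));
        [apply continuous_on_strip_electric_field|exact Ht|apply H0c].
    + apply (continuous_minus (fun s => W (Rmax 0 s)) (fun _ => e0)).
      * apply is_tderive_continuous with (rho 0 t * u 0 t); [apply Ht|now apply HW].
      * apply continuous_const.
  - intros x t Ht.
    apply (is_tderive_ext_strip T (fun s => RInt (fun x => rho x s) 0 x - (W s - e0)));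
      [exact Ht| |].
    + intros s Hs.
      rewrite (is_RInt_unique (fun x => rho x s) 0 x
                 (minus (electric_field rho x s) (electric_field rho 0 s))).
      * unfold minus, plus, opp. simpl. unfold opp. simpl. ring.
      * apply (is_RInt_derive (fun y => electric_field rho y s) (fun x => rho x s)).
        -- intros y _. now apply hsol.
        -- intros y _. apply (continuous_on_strip_x T); [apply hsol|exact Hs].
    + replace (- (rho x t * u x t)) with
        (rho 0 t * u 0 t - rho x t * u x t - (rho 0 t * u 0 t - 0)) by ring.
      apply is_tderive_minus; [apply Ht|now apply hsol|].
      apply is_tderive_minus; [apply Ht|now apply HW|].
      apply is_derive_is_tderive. exact (is_derive_const e0 t).
Qed.

(** The errors [p] in velocity and [r] in field satisfy [p' = k r - u_x p] and [r' = - rho p]: in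
    [r'] the term [rho Y'] comes from the Poisson equation and [- rho u] from the stream function.
    Both errors vanish at time 0. *)
Lemma flow_with_drift :
  exists g F dF : R -> R, g 0 = 0 /\ F 0 = 0 /\ dF 0 = 0 /\
    (forall t, in_time T t -> is_tderive F t (dF t) /\ is_tderive dF t (k * g t)) /\
    (forall x t, in_time T t ->
       is_tderive (fun s => electric_field rho x s - g s) t (- (rho x t * u x t))) /\
    forall a t, in_time T t ->
      u (flow k u0 E0 a t + F t) t = velocity k u0 E0 a t + dF t /\
      electric_field rho (flow k u0 E0 a t + F t) t = E0 a + g t.
Proof.
  destruct exists_stream_function as [g [g0 [cg Hg]]].
  destruct (exists_antiderivative T (fun t => k * g t)) as [dF [dF0 HdF]].
  { intros t Ht. apply (continuous_mult (fun _ => k) (fun s => g (Rmax 0 s)));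
      [apply continuous_const|now apply cg]. }
  destruct (exists_antiderivative T dF) as [F [F0 HF]].
  { intros t Ht. apply is_tderive_continuous with (k * g t); [apply Ht|now apply HdF]. }
  exists g, F, dF. repeat (split; [solve [auto]|]).
  intros a t1 Ht1.
  destruct (sol_momentum _ _ _ _ _ _ hsol) as [ux [ut [[du [cu [cux cut]]] Hm]]].
  set (Y := fun t => flow k u0 E0 a t + F t).
  set (dY := fun t => velocity k u0 E0 a t + dF t).
  set (p := fun t => u (Y t) t - dY t).
  set (r := fun t => electric_field rho (Y t) t - g t - E0 a).
  assert (Hin : forall t, 0 <= t <= t1 -> in_time T t)
    by (intros t; now apply in_time_le).
  assert (HY : forall t, in_time T t -> is_tderive Y t (dY t)).
  { intros t Ht. apply is_tderive_plus; [apply Ht| |now apply HF].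
    apply is_derive_is_tderive, is_derive_flow_time. }
  assert (Hp : forall t, in_time T t ->
            is_tderive p t (k * r t - ux (Y t) t * p t)).
  { intros t Ht.
    replace (k * r t - ux (Y t) t * p t) with
      (ux (Y t) t * dY t + ut (Y t) t - (k * E0 a + k * g t)).
    - apply is_tderive_minus; [apply Ht| |].
      + apply (is_tderive_along T u ux Y); [|exact cux|exact Ht|now apply HY|now apply du].
        intros x s Hs. now apply du.
      + apply is_tderive_plus; [apply Ht| |now apply HdF].
        apply is_derive_is_tderive, is_derive_velocity_time.
    - unfold r, p. assert (E := Hm (Y t) t Ht).
      replace (ut (Y t) t) with
        (k * electric_field rho (Y t) t - u (Y t) t * ux (Y t) t) by lra. ring. }
  assert (Hr : forall t, in_time T t -> is_tderive r t (- rho (Y t) t * p t)).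
  { intros t Ht.
    replace (- rho (Y t) t * p t) with
      (rho (Y t) t * dY t + - (rho (Y t) t * u (Y t) t) - 0) by (unfold p; ring).
    apply (is_tderive_minus (fun s => electric_field rho (Y s) s - g s) (fun _ => E0 a));
      [apply Ht| |apply is_derive_is_tderive; exact (is_derive_const (E0 a) t)].
    apply (is_tderive_along T (fun x s => electric_field rho x s - g s) rho Y);
      [|apply hsol|exact Ht|now apply HY|now apply Hg].
    intros x s Hs. replace (rho x s) with (minus (rho x s) 0)
      by (unfold minus, plus, opp; simpl; ring).
    apply (is_derive_minus (fun y => electric_field rho y s) (fun _ => g s));
      [now apply hsol|exact (is_derive_const (g s) x)]. }
  assert (Hb : forall f, continuous_on_strip T f -> bounded_on t1 (fun t => f (Y t) t)).
  { intros f Hf. apply bounded_on_continuous. intros t Ht.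
    apply (continuous_along T f Y); [exact Hf|now apply Hin|].
    apply is_tderive_continuous with (dY t); [apply Ht|now apply HY, Hin]. }
  destruct (Hb ux cux) as [B1 HB1].
  destruct (Hb rho (sol_rho_continuous _ _ _ _ _ _ hsol)) as [B2 HB2].
  (* Since [2 |p r| <= p^2 + r^2], the derivative of [p^2 + r^2] is at most [2 B1 + k + B2] times
     it, with [B1] and [B2] bounding [u_x] and [rho] along the parabola on [[0, t1]]. *)
  assert (Hz : p t1 * p t1 + r t1 * r t1 <= 0).
  { apply (gronwall_zero (fun t => p t * p t + r t * r t)
      (fun t => (k * r t - ux (Y t) t * p t) * p t + p t * (k * r t - ux (Y t) t * p t)
                + (- rho (Y t) t * p t * r t + r t * (- rho (Y t) t * p t)))
      (2 * B1 + k + B2) t1); [apply Ht1| | |].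
    - intros t Ht. assert (Hi := Hin t Ht).
      apply is_tderive_plus; [apply Ht| |];
        (apply is_tderive_mult; [apply Ht| |]; auto).
    - intros t Ht. specialize (HB1 t Ht). specialize (HB2 t Ht). simpl in HB1, HB2.
      apply Rcomplements.Rabs_le_between in HB1, HB2.
      set (x := p t). set (y := r t). set (b1 := ux (Y t) t) in *.
      set (b2 := rho (Y t) t) in *.
      assert (0 <= (B1 + b1) * (x * x)) by (apply Rmult_le_pos; [lra|apply Rle_0_sqr]).
      assert (0 <= B1 * (y * y)) by (apply Rmult_le_pos; [lra|apply Rle_0_sqr]).
      assert (0 <= k * ((x - y) * (x - y)))
        by (apply Rmult_le_pos; [lra|apply Rle_0_sqr]).
      assert (0 <= (B2 + b2) * ((x + y) * (x + y)))
        by (apply Rmult_le_pos; [lra|apply Rle_0_sqr]).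
      assert (0 <= (B2 - b2) * ((x - y) * (x - y)))
        by (apply Rmult_le_pos; [lra|apply Rle_0_sqr]).
      nra.
    - assert (H0 := in_time_0 t1 Ht1).
      assert (EY : Y 0 = a) by (unfold Y, flow; rewrite F0; ring).
      unfold p, r. rewrite EY, g0, electric_field_0, (sol_u_init _ _ _ _ _ _ hsol) by exact H0.
      unfold dY, velocity. rewrite dF0. ring. }
  assert (Hp0 : p t1 * p t1 = 0) by (assert (A1 := Rle_0_sqr (p t1));
    assert (A2 := Rle_0_sqr (r t1)); unfold Rsqr in *; lra).
  assert (Hr0 : r t1 * r t1 = 0) by (assert (A1 := Rle_0_sqr (p t1));
    assert (A2 := Rle_0_sqr (r t1)); unfold Rsqr in *; lra).
  apply Rsqr_0_uniq in Hp0. apply Rsqr_0_uniq in Hr0.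
  unfold p, r, Y, dY in *. split; lra.
Qed.

(** At a zero of [Gamma] the label derivative of the field along the drifted flow would be 0, yet it
    equals [rho0 a > 0]. So [Gamma] never vanishes, and it starts at 1. The unknown [g] depends on
    time only and drops out of the label derivative. *)
Lemma solution_Gamma_pos a t : in_time T t -> 0 < Gamma k rho0 u0 a t.
Proof.
  destruct flow_with_drift as [g [F [dF [_ [_ [_ [_ [_ HE]]]]]]]].
  assert (Hn : forall s, in_time T s -> Gamma k rho0 u0 a s <> 0).
  { intros s Hs H0. assert (D : is_derive (fun a => E0 a + g s) a 0).
    { apply is_derive_ext with (fun a => electric_field rho (flow k u0 E0 a s + F s) s).
      - intros b. now apply HE.
      - replace 0 with (Gamma k rho0 u0 a s * rho (flow k u0 E0 a s + F s) s)
          by (rewrite H0; ring).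
        apply (is_derive_comp (fun x => electric_field rho x s)
                 (fun a => flow k u0 E0 a s + F s)); [now apply hsol|].
        replace (Gamma k rho0 u0 a s) with (plus (Gamma k rho0 u0 a s) 0)
          by (unfold plus; simpl; ring).
        apply (is_derive_plus (fun a => flow k u0 E0 a s) (fun _ => F s));
          [now apply is_derive_flow_label|exact (is_derive_const (F s) a)]. }
    assert (D' : is_derive (fun a => E0 a + g s) a (plus (rho0 a) 0)).
    { apply (is_derive_plus E0 (fun _ => g s)); [apply hE0|].
      exact (is_derive_const (g s) a). }
    apply is_derive_unique in D. apply is_derive_unique in D'.
    rewrite D in D'. unfold plus in D'. simpl in D'.
    assert (P := hrho0_pos a). lra. }
  intros Ht. destruct (Rlt_le_dec 0 (Gamma k rho0 u0 a t)) as [H|H]; [exact H|exfalso].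
  assert (G0 : Gamma k rho0 u0 a 0 = 1) by (unfold Gamma; ring).
  destruct (IVT_gen (Gamma k rho0 u0 a) 0 t 0) as [s [Hs E]].
  - intros s. apply continuity_pt_filterlim, (ex_derive_continuous (Gamma k rho0 u0 a)).
    eexists. apply is_derive_Gamma_time.
  - rewrite G0, Rmin_right, Rmax_left by lra. lra.
  - destruct Ht as [Ht HT]. rewrite Rmin_left, Rmax_right in Hs by exact Ht.
    apply (Hn s); [|exact E]. apply in_time_le with t; [split; assumption|exact Hs].
Qed.

(* The field tends to opposite values at both ends, for the solution as for
   the initial data, which forces [g = 0]. *)
Lemma solution_along_flow :
  (forall a t, in_time T t ->
     u (flow k u0 E0 a t) t = velocity k u0 E0 a t /\
     electric_field rho (flow k u0 E0 a t) t = E0 a) /\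
  (forall x t, in_time T t ->
     is_tderive (electric_field rho x) t (- (rho x t * u x t))).
Proof.
  destruct flow_with_drift as [g [F [dF [g0 [F0 [dF0 [HF [Hg HE]]]]]]]].
  assert (gz : forall t, in_time T t -> g t = 0).
  { intros t Ht.
    destruct (electric_field_correct rho t) as [_ [Q [HQp HQm]]].
    { intros x. apply (continuous_on_strip_x T); [apply hsol|exact Ht]. }
    { now apply hsol. }
    destruct (flow_limits_strip k q rho0 u0 E0 hk hu0 hE0 hE0p hE0m T
                solution_Gamma_pos t Ht) as [Lp Lm].
    assert (Cp : is_lim (fun a => electric_field rho (flow k u0 E0 a t + F t) t) p_infty Q).
    { apply (is_lim_comp (fun y => electric_field rho y t)
        (fun a => flow k u0 E0 a t + F t) p_infty Q p_infty); [exact HQp| |].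
      - apply (is_lim_plus (fun a => flow k u0 E0 a t) (fun _ => F t) p_infty p_infty (F t));
          [exact Lp|apply is_lim_const|reflexivity].
      - exists 0. discriminate. }
    assert (Cm : is_lim (fun a => electric_field rho (flow k u0 E0 a t + F t) t) m_infty (- Q)).
    { apply (is_lim_comp (fun y => electric_field rho y t)
        (fun a => flow k u0 E0 a t + F t) m_infty (- Q) m_infty); [exact HQm| |].
      - apply (is_lim_plus (fun a => flow k u0 E0 a t) (fun _ => F t) m_infty m_infty (F t));
          [exact Lm|apply is_lim_const|reflexivity].
      - exists 0. discriminate. }
    assert (Dp : is_lim (fun a => electric_field rho (flow k u0 E0 a t + F t) t)
                   p_infty (q + g t)).
    { apply is_lim_ext with (fun a => E0 a + g t); [intros a; symmetry; now apply HE|].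
      apply (is_lim_plus E0 (fun _ => g t) p_infty q (g t));
        [exact hE0p|apply is_lim_const|reflexivity]. }
    assert (Dm : is_lim (fun a => electric_field rho (flow k u0 E0 a t + F t) t)
                   m_infty (- q + g t)).
    { apply is_lim_ext with (fun a => E0 a + g t); [intros a; symmetry; now apply HE|].
      apply (is_lim_plus E0 (fun _ => g t) m_infty (- q) (g t));
        [exact hE0m|apply is_lim_const|reflexivity]. }
    (* Comparing limits gives [Q = q + g t] and [- Q = - q + g t]; their sum yields [g t = 0]. *)
    apply is_lim_unique in Cp. apply is_lim_unique in Cm.
    apply is_lim_unique in Dp. apply is_lim_unique in Dm.
    rewrite Cp in Dp. rewrite Cm in Dm. injection Dp as Ep. injection Dm as Em. lra. }
  assert (dFz : forall t, in_time T t -> dF t = 0).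
  { intros t Ht. rewrite <- dF0. apply (tderive_zero_const T); [|exact Ht].
    intros s Hs. rewrite <- (Rmult_0_r k), <- (gz s Hs) at 1. now apply HF. }
  assert (Fz : forall t, in_time T t -> F t = 0).
  { intros t Ht. rewrite <- F0. apply (tderive_zero_const T); [|exact Ht].
    intros s Hs. rewrite <- (dFz s Hs). now apply HF. }
  split.
  - intros a t Ht. destruct (HE a t Ht) as [H1 H2].
    rewrite (Fz t Ht), (dFz t Ht), !Rplus_0_r in H1.
    rewrite (Fz t Ht), (gz t Ht), !Rplus_0_r in H2. now split.
  - intros x t Ht.
    apply (is_tderive_ext_strip T (fun s => electric_field rho x s - g s));
      [exact Ht| |now apply Hg].
    intros s Hs. rewrite (gz s Hs). ring.
Qed.

Lemma flow_characteristic a : characteristic u T a (flow k u0 E0 a).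
Proof.
  split; [unfold flow; ring|]. intros t Ht.
  rewrite (proj1 (proj1 solution_along_flow a t Ht)).
  apply is_derive_is_tderive, is_derive_flow_time.
Qed.

(* The electric field is constant along characteristics and injective in space. *)
Lemma characteristic_unique a X t :
  characteristic u T a X -> in_time T t -> X t = flow k u0 E0 a t.
Proof.
  intros [HX0 HX] Ht. assert (H0 := in_time_0 t Ht).
  destruct solution_along_flow as [Hf Ht'].
  assert (HE : electric_field rho (X t) t = E0 a).
  { rewrite <- (electric_field_0 a H0), <- HX0.
    apply (tderive_zero_const T (fun s => electric_field rho (X s) s)); [|exact Ht].
    intros s Hs. replace 0 with (rho (X s) s * u (X s) s + - (rho (X s) s * u (X s) s)) by ring.
    apply (is_tderive_along T (electric_field rho) rho X);
      [|apply hsol|exact Hs|now apply HX|now apply Ht'].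
    intros x r Hr. now apply hsol. }
  (* Every point is reached by the flow, so [X t] has a label; its [E0] equals that of [a], and [E0]
     is strictly increasing. *)
  destruct (exists_inverse_flow k q rho0 u0 E0 hk hu0 hE0 hE0p hE0m T
              solution_Gamma_pos) as [A HA].
  rewrite <- (HA (X t) t Ht), (proj2 (Hf _ t Ht)) in HE.
  rewrite <- (HA (X t) t Ht). f_equal.
  destruct (Rtotal_order (A (X t) t) a) as [H|[H|H]]; [|exact H|];
    apply (derive_pos_incr E0 rho0) in H; trivial; lra.
Qed.

Lemma solution_rho_flow a t :
  in_time T t -> rho (flow k u0 E0 a t) t = rho0 a / Gamma k rho0 u0 a t.
Proof.
  intros Ht. assert (HG := solution_Gamma_pos a t Ht).
  assert (D : is_derive E0 a (Gamma k rho0 u0 a t * rho (flow k u0 E0 a t) t)).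
  { apply is_derive_ext with (fun a => electric_field rho (flow k u0 E0 a t) t).
    - intros b. now apply solution_along_flow.
    - apply (is_derive_comp (fun x => electric_field rho x t) (fun a => flow k u0 E0 a t));
        [now apply hsol|now apply is_derive_flow_label]. }
  apply is_derive_unique in D. assert (D' := is_derive_unique _ _ _ (hE0 a)).
  rewrite D in D'. rewrite <- D'. field. lra.
Qed.

Lemma solution_ux_flow a t :
  in_time T t ->
  u_x u (flow k u0 E0 a t) t = velocity_a k rho0 u0 a t / Gamma k rho0 u0 a t.
Proof.
  intros Ht. assert (HG := solution_Gamma_pos a t Ht).
  destruct (sol_momentum _ _ _ _ _ _ hsol) as [ux [ut [[du _] _]]].
  assert (D : is_derive (fun a => velocity k u0 E0 a t) a
                (Gamma k rho0 u0 a t * ux (flow k u0 E0 a t) t)).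
  { apply is_derive_ext with (fun a => u (flow k u0 E0 a t) t).
    - intros b. now apply solution_along_flow.
    - apply (is_derive_comp (fun x => u x t) (fun a => flow k u0 E0 a t));
        [now apply du|now apply is_derive_flow_label]. }
  assert (D' := is_derive_velocity_label k rho0 u0 E0 hu0 hE0 a t).
  apply is_derive_unique in D. apply is_derive_unique in D'.
  rewrite D in D'. rewrite <- D'. unfold u_x.
  replace (Derive (fun y => u y t) (flow k u0 E0 a t)) with (ux (flow k u0 E0 a t) t)
    by (symmetry; apply is_derive_unique; now apply du).
  field. lra.
Qed.

End Uniqueness.

(** * Regularity of the density *)

Section Regularity.

Variables (k : R) (rho0 u0 : R -> R).
Hypothesis hrho0 : C1 rho0.
Hypothesis hu0 : C2 u0.

Definition Gamma_a (a t : R) : R :=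
  Derive (Derive u0) a * t + k / 2 * Derive rho0 a * t ^ 2.

(** Label derivative of the Lagrangian density [rho0 a / Gamma]; [density_t] is its time
    derivative. *)
Definition density_a (a t : R) : R :=
  (Derive rho0 a * Gamma k rho0 u0 a t - rho0 a * Gamma_a a t)
    / (Gamma k rho0 u0 a t * Gamma k rho0 u0 a t).

Definition density_t (a t : R) : R :=
  - (rho0 a * velocity_a k rho0 u0 a t) / (Gamma k rho0 u0 a t * Gamma k rho0 u0 a t).

Lemma is_derive_Gamma_label a t :
  is_derive (fun a => Gamma k rho0 u0 a t) a (Gamma_a a t).
Proof.
  unfold Gamma, Gamma_a. auto_derive.
  - split; [apply hu0|]. split; [apply hrho0|trivial].
  - change (Derive (fun x : R => rho0 x) a) with (Derive rho0 a).
    change (Derive (fun x : R => Derive u0 x) a)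
      with (Derive (Derive u0) a). ring.
Qed.

Lemma is_derive_density_label a t :
  0 < Gamma k rho0 u0 a t ->
  is_derive (fun a => rho0 a / Gamma k rho0 u0 a t) a (density_a a t).
Proof.
  intros HG. unfold density_a.
  replace (Gamma k rho0 u0 a t * Gamma k rho0 u0 a t)
    with (Gamma k rho0 u0 a t ^ 2) by ring.
  apply (is_derive_div rho0 (fun a => Gamma k rho0 u0 a t)); [| |lra].
  - apply Derive_correct, hrho0.
  - apply is_derive_Gamma_label.
Qed.

Lemma is_derive_density_time a t :
  0 < Gamma k rho0 u0 a t ->
  is_derive (fun s => rho0 a / Gamma k rho0 u0 a s) t (density_t a t).
Proof.
  intros HG. unfold density_t.
  replace (- (rho0 a * velocity_a k rho0 u0 a t) /
           (Gamma k rho0 u0 a t * Gamma k rho0 u0 a t))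
    with ((0 * Gamma k rho0 u0 a t - rho0 a * velocity_a k rho0 u0 a t)
          / Gamma k rho0 u0 a t ^ 2) by (field; lra).
  apply (is_derive_div (fun _ => rho0 a) (Gamma k rho0 u0 a)); [| |lra].
  - exact (is_derive_const (rho0 a) t).
  - apply is_derive_Gamma_time.
Qed.

Lemma continuous_on_strip_density (T : Rbar) :
  (forall a t, in_time T t -> 0 < Gamma k rho0 u0 a t) ->
  continuous_on_strip T density_a /\ continuous_on_strip T density_t.
Proof.
  intros HG.
  assert (cG := continuous_on_strip_Gamma k rho0 u0 hrho0 (proj1 hu0) T).
  assert (cGG : continuous_on_strip T
            (fun a t => Gamma k rho0 u0 a t * Gamma k rho0 u0 a t))
    by now apply continuous_on_strip_mult.
  assert (Hn : forall a t, in_time T t ->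
            Gamma k rho0 u0 a t * Gamma k rho0 u0 a t <> 0).
  { intros a t Ht. assert (H := HG a t Ht). nra. }
  assert (cr : continuous_on_strip T (fun a _ => rho0 a))
    by (apply continuous_on_strip_space; intros x;
        apply (ex_derive_continuous rho0), hrho0).
  assert (cGa : continuous_on_strip T Gamma_a).
  { apply continuous_on_strip_plus; apply (continuous_on_strip_mult T).
    - apply continuous_on_strip_space, hu0.
    - apply (continuous_on_strip_time T (fun t => t)). intros t. apply continuous_id.
    - apply (continuous_on_strip_space T (fun a => k / 2 * Derive rho0 a)). intros x.
      apply (continuous_mult (fun _ => k / 2) (Derive rho0));
        [apply continuous_const|apply hrho0].
    - apply (continuous_on_strip_time T (fun t => t ^ 2)). intros t.
      apply (ex_derive_continuous (fun t => t ^ 2)). auto_derive. trivial. }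
  split; apply continuous_on_strip_div; trivial.
  - apply continuous_on_strip_minus; apply continuous_on_strip_mult; trivial.
    apply continuous_on_strip_space, hrho0.
  - apply continuous_on_strip_opp, continuous_on_strip_mult; [exact cr|].
    apply continuous_on_strip_velocity_a; [exact hrho0|apply hu0].
Qed.

(** By uniqueness the density is [rho0 / Gamma] read at the label [A x t]. With [u0] of class [C^2]
    this quotient is [C^1] in label and time, as is [A], and the chain rule supplies the partial
    derivatives. *)
Lemma solution_mass_pointwise (q : R) (E0 : R -> R) (T : Rbar) (rho u : R -> R -> R) :
  0 < k -> (forall a, 0 < rho0 a) ->
  (forall a, is_derive E0 a (rho0 a)) ->
  is_lim E0 p_infty q -> is_lim E0 m_infty (- q) ->
  classical_solution k rho0 u0 T rho u -> mass_pointwise T rho u.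
Proof.
  intros hk hpos hE0 hE0p hE0m hsol. assert (hu1 := proj1 hu0).
  assert (HG : forall a t, in_time T t -> 0 < Gamma k rho0 u0 a t)
    by (intros a t; now apply solution_Gamma_pos with q E0 rho u).
  destruct (exists_inverse_flow k q rho0 u0 E0 hk hu1 hE0 hE0p hE0m T HG) as [A hA].
  assert (dAx := is_derive_inverse_flow k rho0 u0 E0 hrho0 hu1 hE0 T HG A hA).
  assert (dAt := is_tderive_inverse_flow k rho0 u0 E0 hrho0 hu1 hE0 T HG A hA).
  assert (cA : forall phi, continuous_on_strip T phi ->
            continuous_on_strip T (fun x t => phi (A x t) t))
    by (intros phi; now apply (continuous_on_strip_comp_inverse k rho0 u0 E0)).
  destruct (continuous_on_strip_density T HG) as [cDa cDt].
  assert (cG := continuous_on_strip_Gamma k rho0 u0 hrho0 hu1 T).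
  assert (cV := continuous_on_strip_velocity k rho0 u0 E0 hu1 hE0 T).
  assert (Hrho : forall x t, in_time T t ->
            rho0 (A x t) / Gamma k rho0 u0 (A x t) t = rho x t).
  { intros x t Ht. rewrite <- (hA x t Ht) at 3. symmetry.
    now apply solution_rho_flow with (q := q) (u := u) (T := T). }
  destruct (sol_momentum _ _ _ _ _ _ hsol) as [ux [ut [[du _] _]]].
  assert (Hu : forall x t, in_time T t -> u x t = velocity k u0 E0 (A x t) t).
  { intros x t Ht. rewrite <- (hA x t Ht) at 1.
    now apply (solution_along_flow k q rho0 u0 E0 hk hpos hu1 hE0 hE0p hE0m T rho u hsol). }
  assert (Hux : forall x t, in_time T t ->
            ux x t = velocity_a k rho0 u0 (A x t) t / Gamma k rho0 u0 (A x t) t).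
  { intros x t Ht.
    rewrite <- (solution_ux_flow k q rho0 u0 E0 hk hpos hu1 hE0 hE0p hE0m T rho u hsol)
      by exact Ht.
    rewrite hA by exact Ht. symmetry. apply is_derive_unique. now apply du. }
  set (rx := fun x t => density_a (A x t) t / Gamma k rho0 u0 (A x t) t).
  set (rt := fun x t =>
    density_a (A x t) t * (- velocity k u0 E0 (A x t) t / Gamma k rho0 u0 (A x t) t)
    + density_t (A x t) t).
  assert (dr : forall x t, in_time T t -> is_derive (fun y => rho y t) x (rx x t)).
  { intros x t Ht.
    apply is_derive_ext with (fun y => rho0 (A y t) / Gamma k rho0 u0 (A y t) t).
    - intros y. now apply Hrho.
    - unfold rx, Rdiv. rewrite Rmult_comm.
      apply (is_derive_comp (fun a => rho0 a / Gamma k rho0 u0 a t) (fun y => A y t));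
        [now apply is_derive_density_label, HG|now apply dAx]. }
  exists rx, rt. split; [split|].
  - intros x t Ht. split; [now apply dr|].
    apply (is_tderive_ext_strip T (fun s => rho0 (A x s) / Gamma k rho0 u0 (A x s) s));
      [exact Ht|intros s Hs; now apply Hrho|].
    apply (is_tderive_along T (fun a s => rho0 a / Gamma k rho0 u0 a s) density_a (A x));
      [|exact cDa|exact Ht|now apply dAt|].
    + intros a s Hs. now apply is_derive_density_label, HG.
    + now apply is_derive_is_tderive, is_derive_density_time, HG.
  - split; [apply hsol|]. split.
    + apply (cA (fun a t => density_a a t / Gamma k rho0 u0 a t)).
      apply continuous_on_strip_div; [|exact cDa|exact cG].
      intros a t Ht. now apply Rgt_not_eq, HG.
    + apply (cA (fun a t => density_a a t * (- velocity k u0 E0 a t / Gamma k rho0 u0 a t)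
                            + density_t a t)).
      apply continuous_on_strip_plus; [|exact cDt].
      apply continuous_on_strip_mult; [exact cDa|].
      apply continuous_on_strip_div; [|now apply continuous_on_strip_opp|exact cG].
      intros a t Ht. now apply Rgt_not_eq, HG.
  - intros x t Ht.
    assert (D : is_derive (fun y => rho y t * u y t) x
                  (rx x t * u x t + rho x t * ux x t)).
    { apply (is_derive_mult (fun y => rho y t) (fun y => u y t));
        [now apply dr|now apply du|exact Rmult_comm]. }
    split; [now eexists; exact D|].
    replace (Derive (fun y => rho y t * u y t) x)
      with (rx x t * u x t + rho x t * ux x t)
      by (symmetry; now apply is_derive_unique).
    (* The [density_a] terms cancel, as labels at a fixed position move at rate
       [- velocity / Gamma]; what is left is [density_t + rho u_x = 0]. *)
    rewrite Hux, Hu, <- Hrho by exact Ht. unfold rx, rt, density_t.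
    assert (H := HG (A x t) t Ht). field. lra.
Qed.

End Regularity.

(** * The quadratic Gamma *)

(** For [b < 0], complete the square: [2 c] times the quadratic is [(c t + b)^2 + 2 c - b^2], and
    the threshold gives [b^2 < 2 c]. *)
Lemma quadratic_pos (b c t : R) :
  0 < c -> - sqrt (2 * c) < b -> 0 <= t -> 0 < 1 + b * t + c / 2 * t ^ 2.
Proof.
  intros Hc Hb Ht. destruct (Rle_lt_dec 0 b) as [H|H].
  - assert (0 <= b * t) by now apply Rmult_le_pos.
    assert (0 <= c / 2 * t ^ 2) by (apply Rmult_le_pos; [lra|apply pow2_ge_0]). lra.
  - assert (Hs : sqrt (2 * c) * sqrt (2 * c) = 2 * c) by (apply sqrt_sqrt; lra).
    assert (b * b < 2 * c) by (rewrite <- Hs; nra).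
    apply Rmult_lt_reg_l with (2 * c); [lra|].
    assert (0 <= (c * t + b) * (c * t + b)) by apply Rle_0_sqr. nra.
Qed.

(** The discriminant [b^2 - 2 c] is nonnegative, and [d < - b] makes both roots positive. At
    equality in the threshold they coincide. The formula for [b] is Vieta's. *)
Lemma quadratic_factor (b c : R) :
  0 < c -> b <= - sqrt (2 * c) ->
  exists t1 t2, 0 < t1 <= t2 /\ b = - (c / 2) * (t1 + t2) /\
    forall t, 1 + b * t + c / 2 * t ^ 2 = c / 2 * (t1 - t) * (t2 - t).
Proof.
  intros Hc Hb. assert (Hs : sqrt (2 * c) * sqrt (2 * c) = 2 * c) by (apply sqrt_sqrt; lra).
  assert (Hs0 := sqrt_lt_R0 (2 * c) ltac:(lra)).
  assert (Hd : 0 <= b * b - 2 * c) by nra.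
  set (d := sqrt (b * b - 2 * c)).
  assert (Hdd : d * d = b * b - 2 * c) by now apply sqrt_sqrt.
  assert (Hd0 : 0 <= d) by apply sqrt_pos.
  exists ((- b - d) / c), ((- b + d) / c). split; [split|split].
  - apply Rdiv_lt_0_compat; [nra|exact Hc].
  - apply Rmult_le_compat_r; [apply Rlt_le, Rinv_0_lt_compat, Hc|lra].
  - field. lra.
  - intros t. replace (c / 2 * ((- b - d) / c - t) * ((- b + d) / c - t))
      with ((b * b - d * d) / (2 * c) + b * t + c / 2 * t ^ 2) by (field; lra).
    rewrite Hdd. field. lra.
Qed.

(** At distance [d] before [t1] the first denominator is at most [c / 2 * d * t2]. The second
    quotient is a logarithmic derivative, equal to [- (1 / (t1 - t) + 1 / (t2 - t))]; the two terms
    have the same sign, so a double root is no exception. The minimum with [t1] keeps the time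
    nonnegative. *)
Lemma quadratic_blowup (r c t1 t2 : R) :
  0 < r -> 0 < c -> 0 < t1 <= t2 ->
  unbounded_before t1 (fun t => r / (c / 2 * (t1 - t) * (t2 - t))) /\
  unbounded_before t1 (fun t => (- (c / 2) * (t1 + t2) + c * t)
                                / (c / 2 * (t1 - t) * (t2 - t))).
Proof.
  intros Hr Hc Ht. split; intros M; assert (HM := Rabs_pos M); assert (HM' := RRle_abs M).
  - set (e := r / (c / 2 * t2 * (Rabs M + 1))).
    assert (Hp : 0 < c / 2 * t2 * (Rabs M + 1)) by (repeat apply Rmult_lt_0_compat; lra).
    assert (He : 0 < e) by now apply Rdiv_lt_0_compat.
    set (d := Rmin t1 e). assert (Hd : 0 < d) by (apply Rmin_pos; lra).
    assert (Hd1 : d <= t1) by apply Rmin_l. assert (Hd2 : d <= e) by apply Rmin_r.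
    exists (t1 - d). split; [lra|].
    replace (t1 - (t1 - d)) with d by ring.
    assert (Hden : 0 < c / 2 * d * (t2 - (t1 - d)))
      by (apply Rmult_lt_0_compat; [apply Rmult_lt_0_compat|]; lra).
    apply Rlt_le_trans with (2 := RRle_abs _).
    apply Rlt_div_r; [exact Hden|].
    assert (H1 : c / 2 * d * (t2 - (t1 - d)) <= c / 2 * d * t2)
      by (apply Rmult_le_compat_l; [apply Rmult_le_pos|]; lra).
    assert (H2 : c / 2 * t2 * (Rabs M + 1) * d <= r).
    { replace r with (c / 2 * t2 * (Rabs M + 1) * e) by (unfold e; field; lra).
      apply Rmult_le_compat_l; lra. }
    assert (H3 : M * (c / 2 * d * (t2 - (t1 - d))) <= Rabs M * (c / 2 * d * t2)).
    { apply Rle_trans with (Rabs M * (c / 2 * d * (t2 - (t1 - d)))).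
      - apply Rmult_le_compat_r; lra.
      - apply Rmult_le_compat_l; lra. }
    assert (H4 : 0 < c / 2 * d * t2)
      by (apply Rmult_lt_0_compat; [apply Rmult_lt_0_compat|]; lra).
    lra.
  - set (e := / (Rabs M + 1)).
    assert (He : 0 < e) by (apply Rinv_0_lt_compat; lra).
    set (d := Rmin t1 e). assert (Hd : 0 < d) by (apply Rmin_pos; lra).
    assert (Hd1 : d <= t1) by apply Rmin_l. assert (Hd2 : d <= e) by apply Rmin_r.
    exists (t1 - d). split; [lra|].
    replace ((- (c / 2) * (t1 + t2) + c * (t1 - d))
             / (c / 2 * (t1 - (t1 - d)) * (t2 - (t1 - d))))
      with (- (/ d + / (t2 - t1 + d))) by (field; lra).
    rewrite Rabs_Ropp.
    assert (0 < / (t2 - t1 + d)) by (apply Rinv_0_lt_compat; lra).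
    assert (Rabs M + 1 <= / d).
    { rewrite <- (Rinv_inv (Rabs M + 1)). now apply Rinv_le_contravar. }
    apply Rlt_le_trans with (2 := RRle_abs _). lra.
Qed.

Lemma is_lim_inv_infty (f : R -> R) (l : R) :
  continuous f 0 -> f 0 = l -> is_lim (fun t => f (/ t)) p_infty l.
Proof.
  intros Hf <-. apply (filterlim_comp _ _ _ Rinv f _ (locally 0)); [|exact Hf].
  exact (is_lim_inv (fun t => t) p_infty p_infty (is_lim_id p_infty) ltac:(discriminate)).
Qed.

(** Dividing by [t^2] and setting [s = 1 / t] gives rational functions continuous at [s = 0], where
    their values are the limits. *)
Lemma quadratic_decay (r b c : R) :
  0 < c ->
  is_lim (fun t => t ^ 2 * (r / (1 + b * t + c / 2 * t ^ 2))) p_infty (2 * r / c) /\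
  is_lim (fun t => t ^ 1 * ((b + c * t) / (1 + b * t + c / 2 * t ^ 2))) p_infty 2.
Proof.
  intros Hc. assert (Hc2 : c / 2 <> 0) by lra. split.
  - apply is_lim_ext_loc with (fun t => r / ((/ t) ^ 2 + b * / t + c / 2)).
    + exists 0. intros t Ht.
      replace ((/ t) ^ 2 + b * / t + c / 2)
        with ((1 + b * t + c / 2 * t ^ 2) / t ^ 2) by (field; lra).
      unfold Rdiv. rewrite Rinv_mult, Rinv_inv. ring.
    + apply (is_lim_inv_infty (fun s => r / (s ^ 2 + b * s + c / 2))).
      * apply (ex_derive_continuous (fun s => r / (s ^ 2 + b * s + c / 2))).
        auto_derive. lra.
      * field. lra.
  - apply is_lim_ext_loc with (fun t => (b * / t + c) / ((/ t) ^ 2 + b * / t + c / 2)).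
    + exists 0. intros t Ht.
      replace ((/ t) ^ 2 + b * / t + c / 2)
        with ((1 + b * t + c / 2 * t ^ 2) / t ^ 2) by (field; lra).
      unfold Rdiv. rewrite Rinv_mult, Rinv_inv.
      set (D := / (1 + b * t + c * / 2 * t ^ 2)). field. lra.
    + apply (is_lim_inv_infty (fun s => (b * s + c) / (s ^ 2 + b * s + c / 2))).
      * apply (ex_derive_continuous (fun s => (b * s + c) / (s ^ 2 + b * s + c / 2))).
        auto_derive. lra.
      * field. lra.
Qed.

(** * Threshold, decay and breakdown *)

Lemma global_solution_of_classical (k : R) (rho0 u0 : R -> R) (rho u : R -> R -> R) :
  classical_solution k rho0 u0 p_infty rho u -> global_smooth_solution k rho0 u0 rho u.
Proof.
  intros hsol. split; [exact hsol|]. intros a X [_ HX] t1.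
  destruct (sol_momentum _ _ _ _ _ _ hsol) as [ux [ut [[du [_ [cux _]]] _]]].
  (* A characteristic is continuous, so a function continuous on the strip is bounded along it on
     [[0, t1]] by compactness. *)
  assert (Hb : forall f, continuous_on_strip p_infty f -> bounded_on t1 (fun t => f (X t) t)).
  { intros f Hf. apply bounded_on_continuous. intros t Ht.
    assert (Hi : in_time p_infty t) by (split; [apply Ht|exact I]).
    apply (continuous_along p_infty f X); [exact Hf|exact Hi|].
    apply is_tderive_continuous with (u (X t) t); [apply Ht|now apply HX]. }
  split; [apply Hb, hsol|]. apply Hb.
  apply continuous_on_strip_eq with (2 := cux). intros x t Ht.
  symmetry. apply is_derive_unique. now apply du.
Qed.

Lemma Gamma_pos_of_threshold (k : R) (rho0 u0 : R -> R) (a t : R) :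
  0 < k -> 0 < rho0 a -> Derive u0 a > - sqrt (2 * k * rho0 a) -> 0 <= t ->
  0 < Gamma k rho0 u0 a t.
Proof.
  intros Hk Hr Ha Ht. unfold Gamma.
  replace (k / 2 * rho0 a * t ^ 2) with (k * rho0 a / 2 * t ^ 2) by field.
  apply quadratic_pos; [now apply Rmult_lt_0_compat| |exact Ht].
  rewrite <- Rmult_assoc. exact Ha.
Qed.

Lemma Gamma_factor (k : R) (rho0 u0 : R -> R) (a : R) :
  0 < k -> 0 < rho0 a -> ~ (Derive u0 a > - sqrt (2 * k * rho0 a)) ->
  exists t1 t2, 0 < t1 <= t2 /\ Derive u0 a = - (k * rho0 a / 2) * (t1 + t2) /\
    forall t, Gamma k rho0 u0 a t = k * rho0 a / 2 * (t1 - t) * (t2 - t).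
Proof.
  intros Hk Hr Ha.
  destruct (quadratic_factor (Derive u0 a) (k * rho0 a)) as [t1 [t2 [H1 [H2 H3]]]].
  - now apply Rmult_lt_0_compat.
  - rewrite <- Rmult_assoc. lra.
  - exists t1, t2. split; [exact H1|]. split; [exact H2|]. intros t. rewrite <- H3.
    unfold Gamma. field.
Qed.

Theorem theorem2p2 (k : R) (rho0 u0 : R -> R)
    (hk : 0 < k)
    (hrho0_pos : forall x, 0 < rho0 x)
    (hrho0_C1 : C1 rho0)
    (hu0_C1 : C1 u0)
    (hcharge : finite_charge rho0) :
  (* critical threshold *)
  ((exists rho u, global_smooth_solution k rho0 u0 rho u) <->
   (forall alpha, Derive u0 alpha > - sqrt (2 * k * rho0 alpha)))
  /\
  (* the solution along the characteristics, and its decay *)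
  ((forall alpha, Derive u0 alpha > - sqrt (2 * k * rho0 alpha)) ->
   forall rho u, global_smooth_solution k rho0 u0 rho u ->
   forall alpha,
     (exists X, characteristic u p_infty alpha X) /\
     forall X, characteristic u p_infty alpha X ->
       (forall t, 0 <= t ->
          rho (X t) t = rho0 alpha / Gamma k rho0 u0 alpha t /\
          u_x u (X t) t =
            (Derive u0 alpha + k * rho0 alpha * t) / Gamma k rho0 u0 alpha t) /\
       (rho0 alpha <> 0 ->
          decays_like 2 (fun t => rho (X t) t) /\
          decays_like 1 (fun t => u_x u (X t) t)))
  /\
  (* breakdown at the first zero tc of Gamma alpha *)
  (forall alpha, ~ (Derive u0 alpha > - sqrt (2 * k * rho0 alpha)) ->
   exists tc : R,
     0 < tc /\ Gamma k rho0 u0 alpha tc = 0 /\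
     (forall t, 0 <= t < tc -> 0 < Gamma k rho0 u0 alpha t) /\
     (forall T rho u, classical_solution k rho0 u0 T rho u -> Rbar_le T tc) /\
     (forall rho u, classical_solution k rho0 u0 tc rho u ->
        (exists X, characteristic u tc alpha X) /\
        forall X, characteristic u tc alpha X ->
          unbounded_before tc (fun t => rho (X t) t) /\
          unbounded_before tc (fun t => u_x u (X t) t)) /\
     ((forall beta t, 0 <= t < tc -> 0 < Gamma k rho0 u0 beta t) ->
        exists rho u, classical_solution k rho0 u0 tc rho u))
  /\
  (* for u0 of class C^2 the mass equation holds pointwise, with rho of class C^1 *)
  (C2 u0 ->
   forall T rho u, classical_solution k rho0 u0 T rho u -> mass_pointwise T rho u).
Proof.
  (* [E0] is the field of the initial density, viewed as constant in time; [q] is half the total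
     charge. *)
  destruct (electric_field_correct (fun x _ => rho0 x) 0) as [hE0 [q [hE0p hE0m]]].
  { intros x. apply (ex_derive_continuous rho0), hrho0_C1. }
  { exact hcharge. }
  set (E0 := fun y => electric_field (fun x _ => rho0 x) y 0) in *.
  assert (Gpos : forall T rho u, classical_solution k rho0 u0 T rho u ->
            forall a t, in_time T t -> 0 < Gamma k rho0 u0 a t).
  { intros T rho u hsol a t. now apply solution_Gamma_pos with q E0 rho u. }
  assert (Hexists : forall T, Rbar_lt 0 T ->
            (forall a t, in_time T t -> 0 < Gamma k rho0 u0 a t) ->
            exists rho u, classical_solution k rho0 u0 T rho u).
  { intros T HT HG.
    destruct (exists_inverse_flow k q rho0 u0 E0 hk hu0_C1 hE0 hE0p hE0m T HG) as [A hA].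
    exact (solution_exists k q rho0 u0 E0 hrho0_C1 hu0_C1 hE0 hE0p hE0m T HG A hA HT). }
  assert (Hin : forall t, 0 <= t -> in_time p_infty t) by (intros t Ht; now split).
  assert (Hflow : forall T rho u, classical_solution k rho0 u0 T rho u -> forall a,
            (exists X, characteristic u T a X) /\
            forall X, characteristic u T a X -> forall t, in_time T t ->
              rho (X t) t = rho0 a / Gamma k rho0 u0 a t /\
              u_x u (X t) t = velocity_a k rho0 u0 a t / Gamma k rho0 u0 a t).
  { intros T rho u hsol a. split.
    - exists (flow k u0 E0 a). now apply flow_characteristic with q rho0 rho.
    - intros X HX t Ht.
      rewrite (characteristic_unique k q rho0 u0 E0 hk hrho0_pos hu0_C1 hE0 hE0p hE0m
                 T rho u hsol a X t HX Ht).
      split; [now apply solution_rho_flow with q T u|now apply solution_ux_flow with q T rho]. }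
  split; [split|split; [|split]].
  - intros [rho [u [hsol _]]] a.
    destruct (Rlt_le_dec (- sqrt (2 * k * rho0 a)) (Derive u0 a)) as [H|H]; [exact H|exfalso].
    (* Failure of the threshold gives a positive zero of [Gamma], which a solution for all times
       would have to pass. *)
    destruct (Gamma_factor k rho0 u0 a hk (hrho0_pos a)) as [t1 [t2 [Ht [_ E]]]]; [lra|].
    assert (HG := Gpos _ _ _ hsol a t1 (Hin t1 ltac:(lra))). rewrite E in HG. lra.
  - intros Hth. destruct (Hexists p_infty I) as [rho [u hsol]].
    + intros a t [Ht _]. now apply Gamma_pos_of_threshold.
    + exists rho, u. now apply global_solution_of_classical.
  - intros Hth rho u [hsol _] a. destruct (Hflow _ _ _ hsol a) as [HX HXt].
    split; [exact HX|]. intros X hX.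
    assert (HXt' := fun t Ht => HXt X hX t (Hin t Ht)).
    split; [exact HXt'|]. intros _.
    assert (Hr := hrho0_pos a). assert (Hkr := Rmult_lt_0_compat k (rho0 a) hk Hr).
    destruct (quadratic_decay (rho0 a) (Derive u0 a) (k * rho0 a) Hkr) as [L1 L2].
    assert (EG : forall t, Gamma k rho0 u0 a t =
              1 + Derive u0 a * t + k * rho0 a / 2 * t ^ 2)
      by (intros t; unfold Gamma; field).
    (* The first constant is [2 / k], so neither limit depends on the label. *)
    split; [exists (2 * rho0 a / (k * rho0 a))|exists 2].
    + split; [apply Rdiv_lt_0_compat; lra|].
      apply is_lim_ext_loc with (2 := L1). exists 0. intros t Ht.
      rewrite <- EG. f_equal. symmetry. apply HXt'. lra.
    + split; [lra|].
      apply is_lim_ext_loc with (2 := L2). exists 0. intros t Ht.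
      rewrite <- EG. f_equal. symmetry. apply HXt'. lra.
  - intros a Ha.
    destruct (Gamma_factor k rho0 u0 a hk (hrho0_pos a) Ha) as [t1 [t2 [Ht [Eb E]]]].
    assert (Hr := hrho0_pos a). assert (Hkr := Rmult_lt_0_compat k (rho0 a) hk Hr).
    (* The smaller root is the first zero; a solution on a longer interval would contain it in its
       strip, against positivity. *)
    exists t1. split; [lra|]. split; [rewrite E; ring|]. split; [|split; [|split]].
    + intros t Htt. rewrite E. apply Rmult_lt_0_compat; [apply Rmult_lt_0_compat|]; lra.
    + intros T rho u hsol. apply Rbar_not_lt_le. intros HT.
      assert (Ht1 : in_time T t1) by (split; [lra|exact HT]).
      assert (HG := Gpos _ _ _ hsol a t1 Ht1). rewrite E in HG. lra.
    + intros rho u hsol. destruct (Hflow _ _ _ hsol a) as [HX HXt].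
      split; [exact HX|]. intros X hX.
      destruct (quadratic_blowup (rho0 a) (k * rho0 a) t1 t2 Hr Hkr Ht) as [U1 U2].
      split; intros M.
      * destruct (U1 M) as [t [Htt HM]]. exists t. split; [exact Htt|].
        rewrite (proj1 (HXt X hX t Htt)), E. exact HM.
      * destruct (U2 M) as [t [Htt HM]]. exists t. split; [exact Htt|].
        rewrite (proj2 (HXt X hX t Htt)), E. unfold velocity_a. rewrite Eb. exact HM.
    + intros HG. apply Hexists; [simpl; lra|]. intros b t Htt. now apply HG.
  - intros hC2 T rho u hsol. now apply solution_mass_pointwise with k rho0 u0 q E0.
Qed.
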